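(* Let $L^2 \subset \mathbb{R}^4$ be a smooth oriented surface, let $\Lambda^2_-(\mathbb{R}^4)|_L = E \oplus F$ be the splitting into the real line bundle $E$ spanned by $\omega^1$ and its orthogonal complement $F$ of rank $2$, and let $\sigma$ be a smooth section of $F$ over $L$. Let $$X_\sigma = \{(x, \eta + \sigma_x) \in \Lambda^2_-(\mathbb{R}^4)|_L : x \in L,\ \eta \in E_x\}.$$ Then $X_\sigma$ is an associative submanifold of $\mathbb{R}^7 \cong \Lambda^2_-(\mathbb{R}^4)$ if and only if $L$ is minimal in $\mathbb{R}^4$ and $\sigma$ is a holomorphic section of $F$.
   Context: $\Lambda^2_-(\mathbb{R}^4)$ denotes the total space of the bundle of anti-self-dual $2$-forms on Euclidean oriented $\mathbb{R}^4$. For a local oriented orthonormal coframe $e^1,e^2,e^3,e^4$ of $\mathbb{R}^4$, the fibres are spanned by $$\omega^1 = e^1\wedge e^2 - e^3\wedge e^4,\quad \omega^2 = e^1\wedge e^3 - e^4\wedge e^2,\quad \omega^3 = e^1\wedge e^4 - e^2\wedge e^3.$$ The metric on the total space $\Lambda^2_-(\mathbb{R}^4)\cong\mathbb{R}^7$ is the one for which $\bar e_i = (e_i,0)$ ($i=1,\dots,4$) and $\check\omega^i = (0,\omega^i)$ ($i=1,2,3$) form an orthonormal frame. With $\bar e^k$ dual to $\bar e_k$ and $\check\omega_k$ dual to $\check\omega^k$, the canonical torsion-free $\mathrm{G}_2$-structure is $$\varphi = \check\omega_1\wedge\check\omega_2\wedge\check\omega_3 + \check\omega_1\wedge(\bar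 e^1\wedge\bar e^2 - \bar e^3\wedge\bar e^4) + \check\omega_2\wedge(\bar e^1\wedge\bar e^3 - \bar e^4\wedge\bar e^2) + \check\omega_3\wedge(\bar e^1\wedge\bar e^4 - \bar e^2\wedge\bar e^3).$$ A $3$-dimensional submanifold is associative if, for a suitable orientation, $\varphi$ restricts to its volume form (equivalently, the octonion associator vanishes on its tangent spaces, identified with subspaces of $\mathrm{Im}(\mathbb{O})$ via $\varphi$). Along $L$, the coframe is adapted: $\{e^1,e^2\}$ is an oriented orthonormal coframe of $L$ and $\{e^3,e^4\}=\{\nu^1,\nu^2\}$ an orthonormal frame of the conormal bundle, with $(e^1,e^2,\nu^1,\nu^2)$ oriented. Then $\omega^1 = \mathrm{vol}_L - *_{\mathbb{R}^4}\mathrm{vol}_L$ is a globally defined nowhere vanishing section of $\Lambda^2_-(\mathbb{R}^4)|_L$; $E$ is the real line bundle it spans, and $F = E^\perp$ is locally spanned by $\omega^2,\omega^3$. Holomorphic structure: $L$ is a complex curve with complex structure $Je^1 = e^2$, $Je^2=-e^1$. $F$ is a complex line bundle over $L$ with complex structure $J\omega^2=\omega^3$, $J\omega^3=-\omega^2$. The connection $\nabla^F = \pi_F\circ\nabla$ on $F$ is induced by orthogonal projection $\pi_F$ onto $F$ from the Levi-Civita connection $\nabla$ of $\mathbb{R}^4$ (acting on $\Lambda^2_-(\mathbb{R}^4)|_L$), and $F$ is a holomorphic line bundle with $\bar\partial_F = (\nabla^F)^{(0,1)}$. Thus $\sigma$ is holomorphic iff $\nabla^F_{e_1}\sigma + J(\nabla^F_{e_2}\sigma)=0$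 for local oriented orthonormal tangent frames $\{e_1,e_2\}$ of $L$. $L$ is minimal if the trace of its second fundamental form vanishes in every normal direction. *)

(* Defs.v *)
From mathcomp Require Export all_boot all_order all_algebra.
From mathcomp Require Export all_classical all_reals all_analysis.
Export numFieldNormedType.Exports.

Set Implicit Arguments.
Unset Strict Implicit.
Unset Printing Implicit Defensive.

Export Order.TTheory GRing.Theory Num.Theory.
Local Open Scope classical_set_scope.
Local Open Scope ring_scope.

(* Meaningful for open [U]: a map is C^(m+1) iff it is differentiable and all
   its directional derivatives are C^m. *)
Fixpoint Cn_on (R : realType) (k : nat) (W : normedModType R) (m : nat)
    (U : set 'rV[R]_k) (f : 'rV[R]_k -> W) : Prop :=
  match m with
  | 0 => forall q, U q -> {for q, continuous f}
  | m'.+1 => (forall q, U q -> differentiable f q) /\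
             (forall v : 'rV[R]_k, Cn_on m' U (fun q => 'D_v f q))
  end.

Definition smooth_on (R : realType) (k : nat) (W : normedModType R)
    (U : set 'rV[R]_k) (f : 'rV[R]_k -> W) : Prop :=
  forall m, Cn_on m U f.

(* An injective immersion of the open set [U] of R^k which is a homeomorphism
   onto a relatively open subset of [M]. *)
Definition local_param (R : realType) (k n : nat) (M : set 'rV[R]_n)
    (U : set 'rV[R]_k) (f : 'rV[R]_k -> 'rV[R]_n) : Prop :=
  [/\ open U,
      smooth_on U f,
      (forall q w, U q -> 'D_w f q = 0 -> w = 0),
      (forall q q', U q -> U q' -> f q = f q' -> q = q') &
      (forall V : set 'rV[R]_k, open V -> V `<=` U ->
         exists2 O : set 'rV[R]_n, open O & f @` V = M `&` O)].

Definition submanifold (R : realType) (k n : nat) (M : set 'rV[R]_n) : Prop :=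
  forall p, M p ->
    exists (U : set 'rV[R]_k) (f : 'rV[R]_k -> 'rV[R]_n),
      local_param M U f /\ (f @` U) p.

Definition tangent (R : realType) (k n : nat) (M : set 'rV[R]_n)
    (p v : 'rV[R]_n) : Prop :=
  exists (U : set 'rV[R]_k) (f : 'rV[R]_k -> 'rV[R]_n) (q w : 'rV[R]_k),
    [/\ local_param M U f, U q, f q = p & 'D_w f q = v].

(* The derivative of [g] at [p] in the direction of the tangent vector [v]; for
   [g] smooth on [M] it
   does not depend on the local parametrization; it is 0 by convention when
   [v] is not tangent to [M] at [p]. *)
Definition deriv_along (R : realType) (k n : nat) (M : set 'rV[R]_n)
    (W : normedModType R) (g : 'rV[R]_n -> W) (p v : 'rV[R]_n) : W :=
  xget 0 [set d | exists (U : set 'rV[R]_k) (f : 'rV[R]_k -> 'rV[R]_n)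
                         (q w : 'rV[R]_k),
    [/\ local_param M U f, U q, f q = p, 'D_w f q = v & d = 'D_w (g \o f) q]].

(* The image under df(q) of the rows of [A]. *)
Definition push_frame (R : realType) (k n l : nat)
    (f : 'rV[R]_k -> 'rV[R]_n) (q : 'rV[R]_k) (A : 'M[R]_(l, k)) :
    'M[R]_(l, n) :=
  \matrix_(i < l) 'D_(row i A) f q.

(* [o p B] reads: the rows of [B] form a positively oriented frame of T_p M.
   Every frame of T_(f q) M is [push_frame f q A] for some invertible [A], so
   the clause fixes an orientation of each tangent space, and makes it agree
   with the coordinate orientation of a parametrization around each point. *)
Definition orients (R : realType) (k n : nat) (M : set 'rV[R]_n)
    (o : 'rV[R]_n -> 'M[R]_(k, n) -> Prop) : Prop :=
  forall p, M p ->
    exists (U : set 'rV[R]_k) (f : 'rV[R]_k -> 'rV[R]_n),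
      [/\ local_param M U f, (f @` U) p &
          forall q (A : 'M[R]_k), U q ->
            (o (f q) (push_frame f q A) <-> 0 < \det A)].

Definition oriented_onb (R : realType) (k n : nat) (M : set 'rV[R]_n)
    (o : 'rV[R]_n -> 'M[R]_(k, n) -> Prop) (p : 'rV[R]_n) (B : 'M[R]_(k, n)) :
    Prop :=
  [/\ forall i, tangent k M p (row i B), B *m B^T = 1%:M & o p B].

Definition dotv (R : realType) (n : nat) (u v : 'rV[R]_n) : R :=
  (u *m v^T) 0 0.

Definition normal_vector (R : realType) (k n : nat) (M : set 'rV[R]_n)
    (p nu : 'rV[R]_n) : Prop :=
  forall v, tangent k M p v -> dotv v nu = 0.

(* <II(df(u), df(w)), nu> at [f q], for [nu] normal: as df(w) is a tangent
   vector field extending its value at [q], II(df(u), df(w)) is the normal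
   component of its derivative along df(u). *)
Definition second_fundamental_form (R : realType) (k n : nat)
    (f : 'rV[R]_k -> 'rV[R]_n) (q : 'rV[R]_k) (nu : 'rV[R]_n)
    (u w : 'rV[R]_k) : R :=
  dotv ('D_u (fun y => 'D_w f y) q) nu.

Definition minimal (R : realType) (k n : nat) (M : set 'rV[R]_n) : Prop :=
  forall (U : set 'rV[R]_k) (f : 'rV[R]_k -> 'rV[R]_n) (q : 'rV[R]_k)
         (A : 'M[R]_k) (nu : 'rV[R]_n),
    local_param M U f -> U q ->
    push_frame f q A *m (push_frame f q A)^T = 1%:M ->
    normal_vector k M (f q) nu ->
    \sum_(i < k) second_fundamental_form f q nu (row i A) (row i A) = 0.

(* A 2-form [a] is the skew-symmetric matrix
    of its values a(e_i, e_j); vectors and covectors of R^4 are identified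
    through the Euclidean metric. *)

Definition wedge (R : realType) (x y : 'rV[R]_4) : 'M[R]_4 :=
  x^T *m y - y^T *m x.

(* The rows of [e] are the coframe e^1, ..., e^4. *)
Definition omega1 (R : realType) (e : 'M[R]_4) : 'M[R]_4 :=
  wedge (row 0 e) (row 1 e) - wedge (row 2 e) (row 3 e).
Definition omega2 (R : realType) (e : 'M[R]_4) : 'M[R]_4 :=
  wedge (row 0 e) (row 2 e) - wedge (row 3 e) (row 1 e).
Definition omega3 (R : realType) (e : 'M[R]_4) : 'M[R]_4 :=
  wedge (row 0 e) (row 3 e) - wedge (row 1 e) (row 2 e).

(* The isometry of R^3 onto the fibre given by the standard coframe. *)
Definition asd_form (R : realType) (a : 'rV[R]_3) : 'M[R]_4 :=
  a 0 0 *: omega1 1%:M + a 0 1 *: omega2 1%:M + a 0 2 *: omega3 1%:M.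

Definition anti_self_dual (R : realType) (a : 'M[R]_4) : Prop :=
  exists c : 'rV[R]_3, a = asd_form c.

(* The factor 1/4 makes omega^1, omega^2, omega^3 orthonormal. *)
Definition dot_form (R : realType) (a b : 'M[R]_4) : R :=
  4^-1 * \tr (a *m b^T).

(* The rows of [e] are an adapted oriented orthonormal frame
   (e_1, e_2, nu_1, nu_2) of R^4 at [p]. *)
Definition adapted_frame (R : realType) (L : set 'rV[R]_4)
    (o : 'rV[R]_4 -> 'M[R]_(2, 4) -> Prop) (p : 'rV[R]_4) (e : 'M[R]_4) :
    Prop :=
  [/\ e *m e^T = 1%:M, \det e = 1 &
      oriented_onb L o p (usubmx (e : 'M[R]_(2 + 2, 4)))].

Definition E_fibre (R : realType) (L : set 'rV[R]_4)
    (o : 'rV[R]_4 -> 'M[R]_(2, 4) -> Prop) (p : 'rV[R]_4) : set 'M[R]_4 :=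
  [set eta | exists (e : 'M[R]_4) (r : R),
     adapted_frame L o p e /\ eta = r *: omega1 e].

Definition F_fibre (R : realType) (L : set 'rV[R]_4)
    (o : 'rV[R]_4 -> 'M[R]_(2, 4) -> Prop) (p : 'rV[R]_4) : set 'M[R]_4 :=
  [set a | anti_self_dual a /\
     forall eta, E_fibre L o p eta -> dot_form a eta = 0].

Definition smooth_section_F (R : realType) (L : set 'rV[R]_4)
    (o : 'rV[R]_4 -> 'M[R]_(2, 4) -> Prop) (sigma : 'rV[R]_4 -> 'M[R]_4) :
    Prop :=
  (forall p, L p -> F_fibre L o p (sigma p)) /\
  (forall (U : set 'rV[R]_2) (f : 'rV[R]_2 -> 'rV[R]_4),
     local_param L U f -> smooth_on U (sigma \o f)).

(* Here and below [e] is an adapted frame at the point considered; the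
   operators do not depend on its choice. *)

Definition J_L (R : realType) (e : 'M[R]_4) (v : 'rV[R]_4) : 'rV[R]_4 :=
  dotv v (row 0 e) *: row 1 e - dotv v (row 1 e) *: row 0 e.

Definition J_F (R : realType) (e a : 'M[R]_4) : 'M[R]_4 :=
  dot_form a (omega2 e) *: omega3 e - dot_form a (omega3 e) *: omega2 e.

Definition proj_F (R : realType) (e a : 'M[R]_4) : 'M[R]_4 :=
  dot_form a (omega2 e) *: omega2 e + dot_form a (omega3 e) *: omega3 e.

(* The Levi-Civita connection of R^4 is flat, hence acts on 2-forms along L by
   differentiating their coefficients. *)
Definition nabla_F (R : realType) (L : set 'rV[R]_4) (e : 'M[R]_4)
    (sigma : 'rV[R]_4 -> 'M[R]_4) (p v : 'rV[R]_4) : 'M[R]_4 :=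
  proj_F e (deriv_along 2 L sigma p v).

(* (nabla_F)^(0,1), evaluated on the tangent vector [v]; for v = e_1 this is
   half of nabla_(e_1) sigma + J (nabla_(e_2) sigma). *)
Definition dbar_F (R : realType) (L : set 'rV[R]_4) (e : 'M[R]_4)
    (sigma : 'rV[R]_4 -> 'M[R]_4) (p v : 'rV[R]_4) : 'M[R]_4 :=
  2^-1 *: (nabla_F L e sigma p v + J_F e (nabla_F L e sigma p (J_L e v))).

Definition holomorphic_section (R : realType) (L : set 'rV[R]_4)
    (o : 'rV[R]_4 -> 'M[R]_(2, 4) -> Prop) (sigma : 'rV[R]_4 -> 'M[R]_4) :
    Prop :=
  forall p e v, L p -> adapted_frame L o p e -> tangent 2 L p v ->
    dbar_F L e sigma p v = 0.

(* In R^7 = R^4 * R^3 the first four coordinates are those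
    of the base, the last three those of the fibre in the standard frame. *)

Definition base_ix (i : 'I_4) : 'I_(4 + 3) := lshift 3 i.
Definition fibre_ix (i : 'I_3) : 'I_(4 + 3) := rshift 4 i.

(* (dx^i /\ dx^j /\ dx^k) evaluated on the rows of [B]. *)
Definition dx3 (R : realType) (n : nat) (i j k : 'I_n) (B : 'M[R]_(3, n)) : R :=
  \det (colsub (tnth [tuple i; j; k]) B).

Definition phi (R : realType) (B : 'M[R]_(3, 4 + 3)) : R :=
  let w1 := fibre_ix 0 in let w2 := fibre_ix 1 in let w3 := fibre_ix 2 in
  let e1 := base_ix 0 in let e2 := base_ix 1 in
  let e3 := base_ix 2 in let e4 := base_ix 3 in
  dx3 w1 w2 w3 B
  + (dx3 w1 e1 e2 B - dx3 w1 e3 e4 B)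
  + (dx3 w2 e1 e3 B - dx3 w2 e4 e2 B)
  + (dx3 w3 e1 e4 B - dx3 w3 e2 e3 B).

Definition associative_submanifold (R : realType) (X : set 'rV[R]_(4 + 3)) :
    Prop :=
  submanifold 3 X /\
  exists o : 'rV[R]_(4 + 3) -> 'M[R]_(3, 4 + 3) -> Prop,
    orients X o /\
    forall p B, X p -> oriented_onb X o p B -> phi B = 1.

Definition X_sigma (R : realType) (L : set 'rV[R]_4)
    (o : 'rV[R]_4 -> 'M[R]_(2, 4) -> Prop) (sigma : 'rV[R]_4 -> 'M[R]_4) :
    set 'rV[R]_(4 + 3) :=
  [set y | L (lsubmx y) /\
     exists2 eta, E_fibre L o (lsubmx y) eta &
       asd_form (rsubmx y) = eta + sigma (lsubmx y)].

(* Main.v *)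
From HB Require Import structures.
From mathcomp Require Import fingroup perm sesquilinear ring lra.
Require Import Defs.
Set Implicit Arguments.
Unset Strict Implicit.
Unset Printing Implicit Defensive.
Local Open Scope classical_set_scope.
Local Open Scope ring_scope.

(** Along an adapted frame (e_1, e_2, nu_1, nu_2) at a point of L, the tangent
    space of X_sigma at t omega^1 + sigma is spanned by omega^1 and
    e_i + a_i, where a_i is the F-component of the derivative of
    t omega^1 + sigma in the direction e_i.  On these three vectors phi^2 equals
    the Gram determinant, i.e. the plane is associative, iff a_2 = J a_1: the
    difference of the two is the squared norm of a_1 + J a_2.  The omega^1-part of
    a_1 + J a_2 is t times the mean curvature vector, turned into an element of
    F, and the sigma-part is 2 dbar sigma; letting t vary separates the two.

    To avoid normalizing frames, X_sigma is parametrized through the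
    unnormalized section asd(d_1 f /\ d_2 f) of E, which is smooth because it is
    bilinear in the derivatives of f. *)

(** * Linear algebra *)

(** Comparing [phi ^+ 2] with the Gram determinant, instead of asking for [phi = 1] on oriented
    orthonormal bases, frees the argument from orientation and normalization: a change of frame
    multiplies both by the square of its determinant, so the criterion can be tested on the Jacobian
    of any chart. The sign is recovered at the end: where the equations hold, [phi] is positive on
    chart frames, and this positivity serves as the orientation of [X_sigma]. The mean curvature
    appears because only normal components of second derivatives survive the pairing with omega^2
    and omega^3, while the mixed derivatives cancel by symmetry. Constant parameter directions that
    are orthonormal only at the point considered therefore suffice; no orthonormal moving frame is
    differentiated. Tangent vectors, derivatives along L and orientations are defined through the
    existence of some chart, so differentiability of chart transitions has to be extracted from the
    topological definition of a chart. *)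

Lemma sum2E (V : nmodType) (F : 'I_2 -> V) : \sum_i F i = F 0 + F 1.
Proof.
rewrite !big_ord_recl big_ord0 addr0.
by congr (F _ + F _); apply/val_inj.
Qed.

Lemma sum3E (V : nmodType) (F : 'I_3 -> V) : \sum_i F i = F 0 + F 1 + F 2.
Proof.
rewrite !big_ord_recl big_ord0 addr0 addrA.
by congr (F _ + F _ + F _); apply/val_inj.
Qed.

Lemma sum4E (V : nmodType) (F : 'I_4 -> V) :
  \sum_i F i = F 0 + F 1 + F 2 + F 3.
Proof.
rewrite !big_ord_recl big_ord0 addr0 !addrA.
by congr (F _ + F _ + F _ + F _); apply/val_inj.
Qed.

Lemma ord2_ind (P : 'I_2 -> Prop) : P 0 -> P 1 -> forall i, P i.
Proof.
move=> P0 P1 [[|[|//]] lti]; [move: P0 | move: P1];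
  by congr P; apply/val_inj.
Qed.

Lemma ord3_ind (P : 'I_3 -> Prop) : P 0 -> P 1 -> P 2 -> forall i, P i.
Proof.
move=> P0 P1 P2 [[|[|[|//]]] lti]; [move: P0 | move: P1 | move: P2];
  by congr P; apply/val_inj.
Qed.

Lemma ord4_ind (P : 'I_4 -> Prop) :
  P 0 -> P 1 -> P 2 -> P 3 -> forall i, P i.
Proof.
move=> P0 P1 P2 P3 [[|[|[|[|//]]]] lti];
  [move: P0 | move: P1 | move: P2 | move: P3]; by congr P; apply/val_inj.
Qed.

Lemma det2E (R : comPzRingType) (M : 'M[R]_2) :
  \det M = M 0 0 * M 1 1 - M 0 1 * M 1 0.
Proof.
rewrite (expand_det_row _ 0) !big_ord_recl big_ord0 /cofactor !det_mx11 !mxE /=.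
rewrite !addn0 expr0 expr1.
do ![rewrite (_ : lift _ _ = 0); last exact/val_inj
    |rewrite (_ : lift _ _ = 1); last exact/val_inj].
ring.
Qed.

Lemma det3E (R : comPzRingType) (M : 'M[R]_3) :
  \det M = M 0 0 * (M 1 1 * M 2 2 - M 1 2 * M 2 1)
         - M 0 1 * (M 1 0 * M 2 2 - M 1 2 * M 2 0)
         + M 0 2 * (M 1 0 * M 2 1 - M 1 1 * M 2 0).
Proof.
rewrite (expand_det_row _ 0) sum3E /cofactor !det2E !mxE /=.
do ![rewrite (_ : lift _ _ = 0); last exact/val_inj
    |rewrite (_ : lift _ _ = 1); last exact/val_inj
    |rewrite (_ : lift _ _ = 2); last exact/val_inj].
rewrite !add0n expr0 expr1 sqrrN expr1n.
ring.
Qed.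

Lemma det4E (R : comPzRingType) (M : 'M[R]_4) :
  let m i j k := M 1 i * (M 2 j * M 3 k - M 2 k * M 3 j)
               - M 1 j * (M 2 i * M 3 k - M 2 k * M 3 i)
               + M 1 k * (M 2 i * M 3 j - M 2 j * M 3 i) in
  \det M = M 0 0 * m 1 2 3 - M 0 1 * m 0 2 3
         + M 0 2 * m 0 1 3 - M 0 3 * m 0 1 2.
Proof.
move=> m; rewrite (expand_det_row _ 0) sum4E /cofactor !det3E /m !mxE /=.
do ![rewrite (_ : lift _ _ = 0); last exact/val_inj
    |rewrite (_ : lift _ _ = 1); last exact/val_inj
    |rewrite (_ : lift _ _ = 2); last exact/val_inj
    |rewrite (_ : lift _ _ = 3); last exact/val_inj].
rewrite !add0n expr0 expr1.
ring.
Qed.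

Lemma row_sqr_gt0 (R : realFieldType) n (a : 'rV[R]_n) :
  a != 0 -> 0 < (a *m a^T) 0 0.
Proof.
move=> a0; rewrite mxE lt_neqAle; apply/andP; split; last first.
  by apply: sumr_ge0 => i _; rewrite mxE -expr2 sqr_ge0.
rewrite eq_sym; apply: contra a0 => /eqP aa0; apply/eqP/rowP => i; rewrite mxE.
have /(_ i) : forall i, a 0 i * a^T i 0 = 0.
  move=> j; apply/eqP; move/eqP: aa0; rewrite psumr_eq0 => [/allP|k _].
    by apply; rewrite mem_index_enum.
  by rewrite mxE -expr2 sqr_ge0.
by rewrite mxE => /eqP; rewrite mulf_eq0 orbb => /eqP.
Qed.

(** The determinant of [G] is kept positive so that orthonormalizing the tangent frame of a chart
    respects its orientation. The first row is made orthogonal to the others once these are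
    orthonormal, hence [G] is block triangular. *)
Lemma gram_schmidt (R : rcfType) k n (M : 'M[R]_(k, n)) : row_free M ->
  exists2 G : 'M[R]_k, 0 < \det G & (G *m M) *m (G *m M)^T = 1%:M.
Proof.
elim: k M => [M _|k IH]; last rewrite -[k.+1]/(1 + k)%N => M freeM.
  by exists 1%:M; [rewrite det1 | apply/matrixP => -[]].
pose a := usubmx (M : 'M[R]_(1 + k, n)); pose M' := dsubmx (M : 'M[R]_(1 + k, n)).
have MaM' : M = col_mx a M' by rewrite /a /M' vsubmxK.
have freeM' : row_free M'.
  apply/row_freeP; have /row_freeP [N MN] := freeM.
  exists (rsubmx (N : 'M[R]_(n, 1 + k))).
  have : M *m row_mx (lsubmx (N : 'M[R]_(n, 1 + k)))
                     (rsubmx (N : 'M[R]_(n, 1 + k))) = 1%:M.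
    by rewrite hsubmxK.
  rewrite MaM' mul_col_row (@scalar_mx_block _ 1 k) => /eq_block_mx.
  by case.
have [G detG oG] := IH _ freeM'.
pose B := G *m M'; pose c := a *m B^T; pose a' := a - c *m B.
(* If [a'] vanished, [(1, - c G)] would be a nonzero vector in the left kernel of [M]. *)
have a'0 : a' != 0.
  apply/eqP => a'0.
  have : row_mx 1%:M (- (c *m G)) *m col_mx a M' = 0.
    by rewrite mul_row_col mul1mx mulNmx -mulmxA -/B.
  rewrite -MaM' => /eqP; rewrite mulmx_free_eq0 // => /eqP.
  move=> /(congr1 (fun X : 'M[R]_(1, 1 + k) => lsubmx X)); rewrite row_mxKl.
  move=> /matrixP/(_ 0 0); rewrite !mxE eqxx => /eqP.
  by rewrite oner_eq0.
have r0 := row_sqr_gt0 a'0; set r := _ 0 0 in r0.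
pose s := (Num.sqrt r)^-1.
have s0 : 0 < s by rewrite invr_gt0 sqrtr_gt0.
have sr : s * s * r = 1.
  by rewrite -expr2 exprVn sqr_sqrtr ?ltW // mulVf // gt_eqF.
have a'a' : a' *m a'^T = r%:M by rewrite [LHS]mx11_scalar.
have a'B : a' *m B^T = 0 by rewrite mulmxBl -mulmxA oG mulmx1 subrr.
exists (block_mx s%:M (- (s *: (c *m G))) 0 G : 'M[R]_(1 + k)).
  by rewrite det_ublock det_scalar1 mulr_gt0.
have -> : (block_mx s%:M (- (s *: (c *m G))) 0 G : 'M[R]_(1 + k)) *m M =
          col_mx (s *: a') B.
  rewrite MaM' mul_block_col mul0mx add0r mul_scalar_mx mulNmx -scalemxAl.
  by rewrite -mulmxA -scalerBr.
rewrite tr_col_mx mul_col_row linearZ /= -!scalemxAl -!scalemxAr a'a' a'B oG.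
have -> : B *m a'^T = 0 by rewrite -[LHS]trmxK trmx_mul trmxK a'B trmx0.
by rewrite !scaler0 scalerA scale_scalar_mx sr -(@scalar_mx_block _ 1 k).
Qed.

(** An orthonormal basis of the kernel of [B^T] completes [B] to an orthogonal matrix; if its
    determinant is -1, the reflection [D = diag(-1, 1)] of the added rows corrects the sign without
    touching [B]. *)
Lemma extend_SO4 (R : rcfType) (B : 'M[R]_(2, 4)) : B *m B^T = 1%:M ->
  exists e : 'M[R]_4, [/\ e *m e^T = 1%:M, \det e = 1 &
                      usubmx (e : 'M[R]_(2 + 2, 4)) = B].
Proof.
move=> oB.
have rkB : \rank (kermx B^T) = 2.
  rewrite mxrank_ker mxrank_tr.
  by rewrite (_ : \rank B = 2) //; apply/eqP/row_freeP; exists B^T.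
have [N freeN NB] : exists2 N : 'M[R]_(2, 4), row_free N & N *m B^T = 0.
  have freeK := row_base_free (kermx B^T).
  have KB : row_base (kermx B^T) *m B^T = 0.
    by apply/eqP; rewrite -sub_kermx eq_row_base.
  by move: (row_base _) freeK KB; rewrite rkB => N; exists N.
have [G _ oG] := gram_schmidt freeN.
set P := G *m N in oG.
have PB : P *m B^T = 0 by rewrite -mulmxA NB mulmx0.
have BP : B *m P^T = 0 by rewrite -[LHS]trmxK trmx_mul trmxK PB trmx0.
have main (Q : 'M[R]_(2, 4)) : Q *m Q^T = 1%:M -> Q *m B^T = 0 -> B *m Q^T = 0 ->
    (col_mx B Q) *m (col_mx B Q)^T = 1%:M.
  move=> QQ QB BQ; rewrite tr_col_mx mul_col_row oB QQ QB BQ.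
  by rewrite -(@scalar_mx_block _ 2 2).
have e1 := main _ oG PB BP.
have /eqP := congr1 determinant e1.
rewrite det_mulmx det_tr det1 -expr2 sqrf_eq1 => /orP[] /eqP de.
  by exists (col_mx B P); split; rewrite ?col_mxKu.
have [D DD detD] : exists2 D : 'M[R]_2, D *m D^T = 1%:M & \det D = -1.
  exists (block_mx (-1)%:M 0 0 1%:M : 'M[R]_(1 + 1)).
    rewrite (@tr_block_mx _ 1 1 1 1) (@mulmx_block _ 1 1 1 1 1 1).
    rewrite !trmx0 !mulmx0 !mul0mx !addr0 !add0r.
    rewrite !tr_scalar_mx -!scalar_mxM mulrNN !mulr1.
    by rewrite (@scalar_mx_block _ 1 1).
  by rewrite (@det_ublock _ 1 1) det_scalar1 det1 mulr1.
exists (col_mx B (D *m P)); split; last by rewrite col_mxKu.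
  apply: main; rewrite ?(trmx_mul D P).
  - by rewrite mulmxA -(mulmxA D) oG mulmx1.
  - by rewrite -mulmxA PB mulmx0.
  - by rewrite mulmxA BP mul0mx.
rewrite (_ : col_mx B (D *m P) = (block_mx 1%:M 0 0 D : 'M[R]_(2 + 2)) *m col_mx B P).
  by rewrite det_mulmx (@det_ublock _ 2 2) det1 detD de mul1r mulrNN mulr1.
by rewrite mul_block_col mul1mx !mul0mx addr0 add0r.
Qed.

(** * Anti-self-dual forms *)

Lemma asd_formE (R : realType) (a : 'rV[R]_3) i j :
  asd_form a i j =
    nth 0 (nth [::] [:: [:: 0; a 0 0; a 0 1; a 0 2];
                        [:: - a 0 0; 0; - a 0 2; a 0 1];
                        [:: - a 0 1; a 0 2; 0; - a 0 0];
                        [:: - a 0 2; - a 0 1; a 0 0; 0]] i) j.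
Proof.
rewrite /asd_form /omega1 /omega2 /omega3 !(mxE, big_ord1).
by elim/ord4_ind: i; elim/ord4_ind: j => /=; ring.
Qed.

Lemma asd_formD (R : realType) (a b : 'rV[R]_3) :
  asd_form (a + b) = asd_form a + asd_form b.
Proof.
have E k : (a + b) 0 k = a 0 k + b 0 k by rewrite mxE.
rewrite /asd_form; move: (omega1 _) (omega2 _) (omega3 _) => w1 w2 w3.
rewrite !E !scalerDl [RHS]addrACA; congr (_ + _); exact: addrACA.
Qed.

Lemma asd_formZ (R : realType) (c : R) (a : 'rV[R]_3) :
  asd_form (c *: a) = c *: asd_form a.
Proof.
have E k : (c *: a) 0 k = c * a 0 k by rewrite mxE.
by rewrite /asd_form !E -!scalerA !scalerDr.
Qed.

(** An anti-self-dual matrix is determined by its first row. Being defined on all matrices, this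
    left inverse of [asd_form] is linear and so commutes with derivatives. *)
Definition asd_coef (R : realType) (a : 'M[R]_4) : 'rV[R]_3 :=
  \row_k nth 0 [:: a 0 1; a 0 2; a 0 3] k.

Lemma asd_formK (R : realType) : cancel (@asd_form R) (@asd_coef R).
Proof.
by move=> a; apply/rowP => k; rewrite mxE !asd_formE; elim/ord3_ind: k.
Qed.

Lemma anti_self_dualK (R : realType) (a : 'M[R]_4) :
  anti_self_dual a -> asd_form (asd_coef a) = a.
Proof. by case=> c ->; rewrite asd_formK. Qed.

Lemma asd_coefD (R : realType) (a b : 'M[R]_4) :
  asd_coef (a + b) = asd_coef a + asd_coef b.
Proof. by apply/rowP; elim/ord3_ind; rewrite !mxE /= ?mxE. Qed.

Lemma asd_coefZ (R : realType) (c : R) (a : 'M[R]_4) :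
  asd_coef (c *: a) = c *: asd_coef a.
Proof. by apply/rowP; elim/ord3_ind; rewrite !mxE /= ?mxE. Qed.

Lemma mulmx44E (R : pzSemiRingType) (A B : 'M[R]_4) i j : (A *m B) i j =
  A i 0 * B 0 j + A i 1 * B 1 j + A i 2 * B 2 j + A i 3 * B 3 j.
Proof. by rewrite mxE sum4E. Qed.

Lemma dotv_row3 (R : realType) (a b : 'rV[R]_3) :
  dotv a b = a 0 0 * b 0 0 + a 0 1 * b 0 1 + a 0 2 * b 0 2.
Proof. by rewrite /dotv mxE sum3E !mxE. Qed.

Lemma asd_form_trace2 (R : realType) (a b : 'rV[R]_3) :
  \tr (asd_form a *m asd_form b) = - 4 * dotv a b.
Proof.
rewrite dotv_row3 /mxtrace sum4E !mulmx44E !asd_formE /=; ring.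
Qed.

Lemma dot_form_asd (R : realType) (a b : 'rV[R]_3) :
  dot_form (asd_form a) (asd_form b) = dotv a b.
Proof.
rewrite /dot_form dotv_row3 /mxtrace sum4E !mulmx44E.
by rewrite ![(_^T) _ _]mxE !asd_formE /=; field.
Qed.

(** The matrices of the three standard forms multiply like the imaginary quaternions, so the trace
    of a triple product is a scalar triple product; it detects the orientation of a frame of the
    fibre. *)
Lemma asd_form_trace3 (R : realType) (C : 'M[R]_3) :
  \tr (asd_form (row 0 C) *m asd_form (row 1 C) *m asd_form (row 2 C)) =
  - 4 * \det C.
Proof.
have E i j : row i C 0 j = C i j by rewrite mxE.
rewrite det3E /mxtrace sum4E !mulmx44E !asd_formE /= !E; ring.
Qed.

(* Up to the factor 2, the coordinates of the anti-self-dual part of u /\ v. *)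
Definition asd_wedge (R : realType) (u v : 'rV[R]_4) : 'rV[R]_3 :=
  \row_k (u *m asd_form (delta_mx 0 k) *m v^T) 0 0.

Lemma asd_wedgeE (R : realType) (u v : 'rV[R]_4) (b : 'rV[R]_3) :
  dotv (asd_wedge u v) b = dotv (u *m asd_form b) v.
Proof.
have E (c : 'rV[R]_3) : dotv (u *m asd_form c) v =
    \sum_j (\sum_i u 0 i * asd_form c i j) * v 0 j.
  by rewrite /dotv mxE; apply: eq_bigr => j _; rewrite mxE [v^T _ _]mxE.
have W k : asd_wedge u v 0 k = dotv (u *m asd_form (delta_mx 0 k)) v.
  by rewrite mxE.
rewrite dotv_row3 !W !E !sum4E !asd_formE /= !mxE /=; ring.
Qed.

Lemma omegaE (R : realType) (e : 'M[R]_4) :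
  [/\ omega1 e = e^T *m omega1 1%:M *m e, omega2 e = e^T *m omega2 1%:M *m e &
      omega3 e = e^T *m omega3 1%:M *m e].
Proof.
have rowE i : row i e = row i 1%:M *m e by rewrite -row_mul mul1mx.
have wE i j : wedge (row i e) (row j e) =
              e^T *m wedge (row i 1%:M) (row j 1%:M) *m e.
  by rewrite /wedge !rowE !trmx_mul mulmxBr mulmxBl !mulmxA.
by split; rewrite /omega1 /omega2 /omega3 !wE -mulmxBl -mulmxBr.
Qed.

(** Multiplication by [e^T], of determinant 1, turns the upper blocks into 1 and 0 by
    orthonormality, so that only the lower right block contributes. *)
Lemma det_complement (R : realType) (e : 'M[R]_4) (N : 'M[R]_(2, 4)) :
  e *m e^T = 1%:M -> \det e = 1 ->
  \det (col_mx (usubmx (e : 'M[R]_(2 + 2, 4))) N : 'M[R]_4) =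
  \det (N *m (dsubmx (e : 'M[R]_(2 + 2, 4)))^T).
Proof.
move=> ee de; rewrite -[LHS]mulr1 -de -(det_tr e) -det_mulmx.
set u := usubmx _; set d := dsubmx _.
have eE : e = col_mx u d by rewrite vsubmxK.
have : col_mx u d *m (row_mx u^T d^T) = 1%:M.
  by rewrite -tr_col_mx -eE.
rewrite mul_col_row (@scalar_mx_block _ 2 2) => /eq_block_mx[uu ud _ _].
rewrite [X in _ *m X^T]eE (@tr_col_mx _ 2 2 4) (@mul_col_row _ 2 2 4 2 2) uu ud.
by rewrite (@det_lblock _ 2 2) det1 mul1r.
Qed.

Lemma det_complement_minor (R : realType) (e : 'M[R]_4) (k l : 'I_4) :
  e *m e^T = 1%:M -> \det e = 1 ->
  \det (\matrix_(i < 4) nth 0 [:: row 0 e; row 1 e; delta_mx 0 k; delta_mx 0 l] i)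
  = e 2 k * e 3 l - e 2 l * e 3 k.
Proof.
move=> ee de.
pose N : 'M[R]_(2, 4) := \matrix_(i < 2) nth 0 [:: delta_mx 0 k; delta_mx 0 l] i.
transitivity (\det (col_mx (usubmx (e : 'M[R]_(2 + 2, 4))) N : 'M[R]_4)).
  congr (\det _); apply/matrixP => i j; rewrite [LHS]mxE.
  have [i' ->|i' ->] := @split_ordP 2 2 i.
    by rewrite (@col_mxEu _ 2 2 4 _ N) mxE; elim/ord2_ind: i' => /=; rewrite mxE;
       congr (e _ _); apply/val_inj.
  by rewrite (@col_mxEd _ 2 2 4 _ N) mxE;
     elim/ord2_ind: i' => /=.
rewrite det_complement // det2E.
have E i j : (N *m (dsubmx (e : 'M[R]_(2 + 2, 4)))^T) i j =
             e (rshift 2 j) (nth 0 [:: k; l] i).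
  rewrite mxE (bigD1 (nth 0 [:: k; l] i)) //= big1 => [|x neq].
    rewrite addr0 [N _ _]mxE (mxE _ _ _ j) (mxE _ _ j).
    by elim/ord2_ind: i; rewrite /= mxE !eqxx mul1r.
  rewrite [N _ _]mxE; move: neq.
  by elim/ord2_ind: i => /= /negPf neq; rewrite mxE neq andbF mul0r.
by rewrite !E /= [X in _ - X]mulrC;
   congr (e _ _ * e _ _ - e _ _ * e _ _); apply/val_inj.
Qed.

Lemma omega1_asd (R : realType) (e : 'M[R]_4) :
  e *m e^T = 1%:M -> \det e = 1 -> asd_form (asd_coef (omega1 e)) = omega1 e.
Proof.
move=> ee de.
have rowE i j : row i e 0 j = e i j by rewrite mxE.
have deltaE (k j : 'I_4) : delta_mx 0 k 0 j = (j == k)%:R :> R by rewrite mxE.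
have entryE (s : seq 'rV[R]_4) i j : (\matrix_(i < 4) nth 0 s i) i j = (nth 0 s i) 0 j.
  by rewrite mxE.
(* Laplace expansion: [p] are the minors of the first two rows of [e], [d] those of two coordinate
   vectors. Each choice of [k] and [l] isolates one complementary minor with its sign, which is the
   Hodge duality of e_1 /\ e_2 and nu_1 /\ nu_2. *)
have minor k l : let p i j := e 0 i * e 1 j - e 0 j * e 1 i in
    let d i j : R := (i == k)%:R * (j == l)%:R - (j == k)%:R * (i == l)%:R in
    p 0 1 * d 2 3 - p 0 2 * d 1 3 + p 0 3 * d 1 2
    + p 1 2 * d 0 3 - p 1 3 * d 0 2 + p 2 3 * d 0 1 =
    e 2 k * e 3 l - e 2 l * e 3 k.
  rewrite -(det_complement_minor k l ee de) det4E !entryE /= !rowE !deltaE /=.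
  ring.
have h01 : e 2 0 * e 3 1 - e 2 1 * e 3 0 = e 0 2 * e 1 3 - e 0 3 * e 1 2.
  by rewrite -minor /=; ring.
have h02 : e 2 0 * e 3 2 - e 2 2 * e 3 0 = e 0 3 * e 1 1 - e 0 1 * e 1 3.
  by rewrite -minor /=; ring.
have h03 : e 2 0 * e 3 3 - e 2 3 * e 3 0 = e 0 1 * e 1 2 - e 0 2 * e 1 1.
  by rewrite -minor /=; ring.
have h23 : e 2 2 * e 3 3 - e 2 3 * e 3 2 = e 0 0 * e 1 1 - e 0 1 * e 1 0.
  by rewrite -minor /=; ring.
have h13 : e 2 1 * e 3 3 - e 2 3 * e 3 1 = e 0 2 * e 1 0 - e 0 0 * e 1 2.
  by rewrite -minor /=; ring.
have h12 : e 2 1 * e 3 2 - e 2 2 * e 3 1 = e 0 0 * e 1 3 - e 0 3 * e 1 0.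
  by rewrite -minor /=; ring.
clear minor.
have wE (x y : 'rV[R]_4) i j : wedge x y i j = x 0 i * y 0 j - y 0 i * x 0 j.
  by rewrite !mxE !big_ord1 !mxE.
have omE i j : omega1 e i j = e 0 i * e 1 j - e 1 i * e 0 j
                            - (e 2 i * e 3 j - e 3 i * e 2 j).
  by rewrite /omega1 mxE [X in _ + X]mxE !wE !rowE.
have cE k : asd_coef (omega1 e) 0 k =
    nth 0 [:: omega1 e 0 1; omega1 e 0 2; omega1 e 0 3] k by rewrite mxE.
apply/matrixP => i j; rewrite asd_formE !cE /= !omE.
by elim/ord4_ind: i; elim/ord4_ind: j; rewrite /=; lra.
Qed.

Lemma omega_std (R : realType) :
  [/\ omega1 1%:M = asd_form (delta_mx 0 0) :> 'M[R]_4,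
      omega2 1%:M = asd_form (delta_mx 0 1) :> 'M[R]_4 &
      omega3 1%:M = asd_form (delta_mx 0 2) :> 'M[R]_4].
Proof.
by split; rewrite /asd_form !mxE /= ?scale1r ?scale0r ?add0r ?addr0.
Qed.

(* The cyclic permutation of the last three rows, which is even, sends
   omega^1 to omega^2 and omega^2 to omega^3. *)
Lemma cycle_frame (R : realType) (e : 'M[R]_4) :
  e *m e^T = 1%:M -> \det e = 1 ->
  exists e' : 'M[R]_4, [/\ e' *m e'^T = 1%:M, \det e' = 1,
    omega1 e' = omega2 e & omega2 e' = omega3 e].
Proof.
move=> ee de; pose s : 'S_4 := mulg (tperm (1 : 'I_4) 2) (tperm 1 3).
have s0 : s 0 = 0 by rewrite permM !tpermD.
have s1 : s 1 = 2 by rewrite permM tpermL tpermD.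
have s2 : s 2 = 3 by rewrite permM tpermR tpermL.
have s3 : s 3 = 1 by rewrite permM (@tpermD _ 1 2) // tpermR.
have rowE i : row i (row_perm s e) = row (s i) e.
  by apply/rowP => j; rewrite !mxE.
exists (row_perm s e); split.
- rewrite row_permE trmx_mul mulmxA -(mulmxA _ e) ee mulmx1 tr_perm_mx.
  by rewrite -perm_mxM mulgV perm_mx1.
- by rewrite row_permE det_mulmx det_perm odd_permM !odd_tperm /= expr0 mul1r.
- by rewrite /omega1 /omega2 !rowE s0 s1 s2 s3.
- by rewrite /omega2 /omega3 !rowE s0 s1 s2 s3.
Qed.

(** Conjugation by [e] preserves the traces of double and triple products, which encode the inner
    product and the orientation of the fibre: this is the homomorphism from SO(4) to SO(3). *)
Lemma asd_frame (R : realType) (e : 'M[R]_4) :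
  e *m e^T = 1%:M -> \det e = 1 ->
  exists C : 'M[R]_3, [/\ C *m C^T = 1%:M, \det C = 1 &
    [/\ asd_form (row 0 C) = omega1 e, asd_form (row 1 C) = omega2 e &
        asd_form (row 2 C) = omega3 e]].
Proof.
move=> ee de.
have [e' [ee' de' o12' o23']] := cycle_frame ee de.
have [e'' [ee'' de'' o12'' _]] := cycle_frame ee' de'.
have as1 := omega1_asd ee de; have as2 := omega1_asd ee' de'.
have as3 := omega1_asd ee'' de''; rewrite o12' in as2; rewrite o12'' o23' in as3.
pose C : 'M[R]_3 := \matrix_k asd_coef
  (nth 0 [:: omega1 e; omega2 e; omega3 e] k).
have Cr0 : asd_form (row 0 C) = omega1 e by rewrite rowK.
have Cr1 : asd_form (row 1 C) = omega2 e by rewrite rowK.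
have Cr2 : asd_form (row 2 C) = omega3 e by rewrite rowK.
have [om1 om2 om3] := omegaE e; have [s1 s2 s3] := omega_std R.
have tr2 (a b : 'M[R]_4) : \tr (e^T *m a *m e *m (e^T *m b *m e)) = \tr (a *m b).
  rewrite !mulmxA mxtrace_mulC !mulmxA ee mul1mx.
  by rewrite -(mulmxA a) ee mulmx1.
have CE i : asd_form (row i C) = e^T *m asd_form (delta_mx 0 i) *m e.
  by elim/ord3_ind: i; rewrite -?s1 -?s2 -?s3 -?om1 -?om2 -?om3.
exists C; split=> //.
  apply/matrixP => i j.
  have -> : (C *m C^T) i j = dotv (row i C) (row j C).
    by rewrite /dotv !mxE; apply: eq_bigr => k _; rewrite !mxE.
  have n4 : (- 4 : R) != 0 by rewrite oppr_eq0 pnatr_eq0.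
  apply: (mulfI n4); rewrite -asd_form_trace2 !CE tr2 asd_form_trace2.
  by rewrite dotv_row3 !mxE; elim/ord3_ind: i; elim/ord3_ind: j => /=; ring.
have n4 : (- 4 : R) != 0 by rewrite oppr_eq0 pnatr_eq0.
apply: (mulfI n4); rewrite -asd_form_trace3 !CE -!(mulmxA _ e).
rewrite !(mulmxA e) ee !mul1mx mulmxA mxtrace_mulC !mulmxA ee mul1mx.
by rewrite -(mulmxA _ e) ee mulmx1 -!row1 asd_form_trace3 det1.
Qed.

(** * The 3-form phi on frames *)

Lemma phiE (R : realType) (P : 'M[R]_(3, 4)) (Q : 'M[R]_3) :
  phi (row_mx P Q) = \det Q
    + dotv (row 0 P *m asd_form (row 2 Q)) (row 1 P)
    + dotv (row 1 P *m asd_form (row 0 Q)) (row 2 P)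
    + dotv (row 2 P *m asd_form (row 1 Q)) (row 0 P).
Proof.
have PE i (j : 'I_4) : row_mx P Q i (base_ix j) = P i j by rewrite row_mxEl.
have QE i (j : 'I_3) : row_mx P Q i (fibre_ix j) = Q i j by rewrite row_mxEr.
have dx3E (i j k : 'I_(4 + 3)) : dx3 i j k (row_mx P Q) =
    \det (\matrix_(a < 3, b < 3)
       row_mx P Q a (nth i [:: i; j; k] b)).
  congr (\det _); apply/matrixP => a b; rewrite !mxE.
  by rewrite (tnth_nth i).
rewrite /phi !dx3E !det3E ![(\matrix_(_, _) _) _ _]mxE /= !PE !QE.
rewrite /dotv ![(_ *m _) _ _]mxE !sum4E ![(_ *m _) _ _]mxE !sum4E.
have E i j : row i Q 0 j = Q i j by rewrite mxE.
have E' i j : row i P 0 j = P i j by rewrite mxE.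
rewrite !asd_formE /= ![(_^T) _ _]mxE !E !E'; ring.
Qed.

Lemma phi_mull (R : realType) (A : 'M[R]_3) (B : 'M[R]_(3, 4 + 3)) :
  phi (A *m B) = \det A * phi B.
Proof.
have dxM i j k : dx3 i j k (A *m B) = \det A * dx3 i j k B.
  by rewrite /dx3 -det_mulmx; congr (\det _); apply/matrixP => a b; rewrite !mxE;
     apply: eq_bigr => c _; rewrite !mxE.
by rewrite /phi !dxM; ring.
Qed.

Lemma dotvE (R : realType) n (u v : 'rV[R]_n) :
  dotv u v = \sum_i u 0 i * v 0 i.
Proof. by rewrite /dotv mxE; apply: eq_bigr => i _; rewrite mxE. Qed.

Lemma dotvC (R : realType) n (u v : 'rV[R]_n) : dotv u v = dotv v u.
Proof. by rewrite !dotvE; apply: eq_bigr => i _; rewrite mulrC. Qed.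

Lemma mulmx_trE (R : realType) m p n (A : 'M[R]_(m, n)) (B : 'M[R]_(p, n)) i j :
  (A *m B^T) i j = dotv (row i A) (row j B).
Proof. by rewrite dotvE mxE; apply: eq_bigr => k _; rewrite !mxE. Qed.

Lemma dotvDl (R : realType) n (u v w : 'rV[R]_n) :
  dotv (u + v) w = dotv u w + dotv v w.
Proof. by rewrite /dotv mulmxDl mxE. Qed.

Lemma dotvZl (R : realType) n c (u w : 'rV[R]_n) :
  dotv (c *: u) w = c * dotv u w.
Proof. by rewrite /dotv -scalemxAl mxE. Qed.

Lemma dotvBl (R : realType) n (u v w : 'rV[R]_n) :
  dotv (u - v) w = dotv u w - dotv v w.
Proof. by rewrite -scaleN1r dotvDl dotvZl mulN1r. Qed.

Lemma dotv0l (R : realType) n (u : 'rV[R]_n) : dotv 0 u = 0.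
Proof. by rewrite /dotv mul0mx mxE. Qed.

Lemma dotv0r (R : realType) n (u : 'rV[R]_n) : dotv u 0 = 0.
Proof. by rewrite dotvC dotv0l. Qed.

Lemma dotv_frame (R : realType) n (e : 'M[R]_n) i j :
  e *m e^T = 1%:M -> dotv (row i e) (row j e) = (i == j)%:R.
Proof. by move=> ee; rewrite -mulmx_trE ee mxE. Qed.

Lemma dotv_wedge (R : realType) (u v x y : 'rV[R]_4) :
  dotv (u *m wedge x y) v = dotv u x * dotv y v - dotv u y * dotv x v.
Proof.
rewrite /wedge mulmxBr dotvBl /dotv !mulmxA.
rewrite [u *m x^T]mx11_scalar [u *m y^T]mx11_scalar !mul_scalar_mx.
by rewrite -!scalemxAl !mxE.
Qed.

Lemma omega_on_frame (R : realType) (e : 'M[R]_4) : e *m e^T = 1%:M ->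
  [/\ dotv (row 0 e *m omega1 e) (row 1 e) = 1,
      dotv (row 0 e *m omega2 e) (row 1 e) = 0 &
      dotv (row 0 e *m omega3 e) (row 1 e) = 0].
Proof.
move=> ee.
have frame i j := dotv_frame i j ee.
split; rewrite /omega1 /omega2 /omega3 mulmxBr dotvBl !dotv_wedge !frame /=; ring.
Qed.

(* Row [i] of [K] holds the coordinates, in the frame omega^1, omega^2, omega^3,
   of the vertical part of the [i]-th vector. *)
Lemma phi_frame (R : realType) (e : 'M[R]_4) (C K : 'M[R]_3) :
  e *m e^T = 1%:M -> C *m C^T = 1%:M -> \det C = 1 ->
  asd_form (row 0 C) = omega1 e -> row 2 K = delta_mx 0 0 ->
  let Y : 'M[R]_(3, 4 + 3) :=
    row_mx (col_mx (usubmx (e : 'M[R]_(2 + 2, 4))) (0 : 'rV[R]_4)) (K *m C) in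
  phi Y = 1 + (K 0 1 * K 1 2 - K 0 2 * K 1 1) /\
  \det (Y *m Y^T) = phi Y ^+ 2
    + ((K 0 1 - K 1 2) ^+ 2 + (K 0 2 + K 1 1) ^+ 2).
Proof.
move=> ee CC dC C0 K2 Y.
have K2E j : K 2 j = (j == 0)%:R by move/rowP: K2 => /(_ j); rewrite !mxE.
have phiY : phi Y = 1 + (K 0 1 * K 1 2 - K 0 2 * K 1 1).
  rewrite /Y phiE det_mulmx dC mulr1 row_mul K2 -rowE C0.
  pose P : 'M[R]_(2 + 1, 4) := col_mx (usubmx (e : 'M[R]_(2 + 2, 4))) 0.
  have P0 : row 0 (P : 'M[R]_(3, 4)) = row 0 e.
    apply/rowP => j; rewrite mxE (_ : P _ _ = P (lshift 1 0) j);
      last by congr (P _ _); exact/val_inj.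
    by rewrite col_mxEu !mxE; congr (e _ _); apply/val_inj.
  have P1 : row 1 (P : 'M[R]_(3, 4)) = row 1 e.
    apply/rowP => j; rewrite mxE (_ : P _ _ = P (lshift 1 1) j);
      last by congr (P _ _); exact/val_inj.
    by rewrite col_mxEu !mxE; congr (e _ _); apply/val_inj.
  have P2 : row 2 (P : 'M[R]_(3, 4)) = 0.
    apply/rowP => j; rewrite mxE (_ : P _ _ = P (rshift 2 0) j);
      last by congr (P _ _); exact/val_inj.
    by rewrite col_mxEd !mxE.
  rewrite P0 P1 P2; have [-> _ _] := omega_on_frame ee.
  rewrite mul0mx dotv0l dotv0r.
  by rewrite det3E !K2E /=; ring.
split=> //; rewrite phiY.
(* The Gram matrix is a base part [D = diag(1, 1, 0)] plus a fibre part, from which the orthogonal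
   matrix [C] cancels. *)
pose D : 'M[R]_3 := (block_mx (1%:M : 'M[R]_2) 0 0 (0 : 'M[R]_1) : 'M[R]_(2 + 1)).
pose u := usubmx (e : 'M[R]_(2 + 2, 4)).
have uu : u *m u^T = 1%:M.
  have eE : e = col_mx u (dsubmx (e : 'M[R]_(2 + 2, 4))) by rewrite vsubmxK.
  move: ee; rewrite [X in X *m X^T]eE (@tr_col_mx _ 2 2 4).
  rewrite (@mul_col_row _ 2 2 4 2 2).
  by rewrite (@scalar_mx_block _ 2 2) => /(@eq_block_mx _ 2 2 2 2)[].
have -> : Y *m Y^T = D + K *m K^T.
  rewrite /Y tr_row_mx mul_row_col trmx_mul mulmxA -(mulmxA K) CC mulmx1.
  congr (_ + _); rewrite (@tr_col_mx _ 2 1 4) (@mul_col_row _ 2 1 4 2 1).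
  by rewrite trmx0 !mulmx0 !mul0mx -/u uu.
have DE i j : D i j = ((i == j) && (i != 2))%:R.
  rewrite /D; have [i' ->|i' ->] := @split_ordP 2 1 i;
    have [j' ->|j' ->] := @split_ordP 2 1 j.
  - rewrite (@block_mxEul _ 2 1 2 1) mxE; congr _%:R.
    by elim/ord2_ind: i'; elim/ord2_ind: j'.
  - by rewrite (@block_mxEur _ 2 1 2 1) mxE; elim/ord2_ind: i'; rewrite !ord1.
  - by rewrite (@block_mxEdl _ 2 1 2 1) mxE; elim/ord2_ind: j'; rewrite !ord1.
  - by rewrite (@block_mxEdr _ 2 1 2 1) mxE !ord1.
have YE i j : (D + K *m K^T) i j =
    ((i == j) && (i != 2))%:R + (K i 0 * K j 0 + K i 1 * K j 1 + K i 2 * K j 2).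
  by rewrite mxE DE mxE sum3E ![K^T _ _]mxE.
(* As the last row of [K] is (1, 0, 0), the omega^1-coordinates of the other rows drop out. If a and
   b are what remains of those rows, the Gram determinant is 1 + |a|^2 + |b|^2 + (a x b)^2, while
   [phi] is 1 + a x b. *)
rewrite det3E !YE !K2E /=.
ring.
Qed.

(** * Differential calculus in finite dimension *)

Lemma differentiable_nearP (R : numFieldType) (V W : normedModType R)
    (f : V -> W) (x : V) : differentiable f x -> forall e : R, 0 < e ->
  \forall y \near x, `|f y - f x - 'd f x (y - x)| <= e * `|y - x|.
Proof.
move=> df e e0; have /eqaddoP/(_ _ e0) := diff_locally df.
rewrite (near_shift 0 x) subr0; apply: filterS => y; rewrite /= addrK.
by rewrite -[X in `|X| <= _ -> _]/(f (y + x) - (f x + 'd f x y)) opprD addrA.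
Qed.

Lemma is_diff_near (R : numFieldType) (V W : normedModType R)
    (f : V -> W) (df : {linear V -> W}) (x : V) : continuous df ->
  (forall e : R, 0 < e ->
     \forall y \near x, `|f y - f x - df (y - x)| <= e * `|y - x|) ->
  is_diff x f df.
Proof.
move=> cdf fdf.
have dxf : f \o shift x = cst (f x) + df +o_ 0 id.
  apply/eqaddoP => e e0; have := fdf e e0.
  rewrite (near_shift 0 x) subr0; apply: filterS => y; rewrite /= addrK.
  by rewrite -[X in _ -> `|X| <= _]/(f (y + x) - (f x + df y)) opprD addrA.
have ddf := diff_unique cdf dxf.
by split=> //; apply/diff_locallyP; rewrite ddf.
Qed.

Lemma near_eq_is_diff (R : numFieldType) (V W : normedModType R)
    (f g : V -> W) (x : V) :
  {near x, f =1 g} -> differentiable f x -> is_diff x g ('d f x).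
Proof.
move=> fg df.
apply: is_diff_near; first exact: (diff_continuous df).
move=> e e0; rewrite -(nbhs_singleton fg).
by apply: filterS2 fg (differentiable_nearP df e0) => y <-.
Qed.

Lemma linear_mx_continuous (R : realType) m n (W : normedModType R)
  (l : {linear 'M[R]_(m, n) -> W}) : continuous l.
Proof.
have lE : l = (fun x : 'M[R]_(m, n) =>
    \sum_i \sum_j x i j *: l (delta_mx i j)) :> (_ -> _).
  apply/funext => x; rewrite {1}(matrix_sum_delta x) linear_sum.
  by apply: eq_bigr => i _; rewrite linear_sum; apply: eq_bigr => j _; rewrite linearZ.
rewrite lE; apply: continuous_big => [|i _]; first exact: add_continuous.
apply: continuous_big => [|j _]; first exact: add_continuous.
move=> x; apply: (continuousZr_tmp (s := fun M : 'M[R]_(m, n) => M i j)).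
exact: coord_continuous.
Qed.

Lemma linear_mx_is_diff (R : realType) m n (W : normedModType R)
  (l : {linear 'M[R]_(m, n) -> W}) x : is_diff x l l.
Proof.
have cl := @linear_mx_continuous R m n W l.
by split; [exact: linear_differentiable | exact: diff_lin].
Qed.

Lemma bilinear_mx_continuous (R : realType) m n p q (W : normedModType R)
  (b : {bilinear 'M[R]_(m, n) -> 'M[R]_(p, q) -> W}) :
  continuous (fun x => b x.1 x.2).
Proof.
have bE : (fun x => b x.1 x.2) = (fun x : 'M[R]_(m, n) * 'M[R]_(p, q) =>
    \sum_i \sum_j x.1 i j *: b (delta_mx i j) x.2) :> (_ -> _).
  apply/funext => x; rewrite {1}(matrix_sum_delta x.1) linear_sumlz.
  apply: eq_bigr => i _; rewrite linear_sumlz; apply: eq_bigr => j _.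
  by rewrite linearZl_LR.
rewrite bE; apply: continuous_big => [|i _]; first exact: add_continuous.
apply: continuous_big => [|j _]; first exact: add_continuous.
move=> x; apply: (@normed_module.continuousZ _ _ _ (fun x : 'M[R]_(m, n) * 'M[R]_(p, q) => x.1 i j)
  (fun x => b (delta_mx i j) x.2)).
  apply: (@continuous_comp _ _ _ fst (fun M : 'M[R]_(m, n) => M i j)).
    exact: cvg_fst.
  exact: coord_continuous.
apply: (@continuous_comp _ _ _ snd (b (delta_mx i j))); first exact: cvg_snd.
exact: linear_mx_continuous.
Qed.

Lemma bilinear_mx_is_diff (R : realType) (V : normedModType R) m n p q
    (W : normedModType R) (b : {bilinear 'M[R]_(m, n) -> 'M[R]_(p, q) -> W})
    (f : V -> 'M[R]_(m, n)) (g : V -> 'M[R]_(p, q)) x :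
  differentiable f x -> differentiable g x ->
  is_diff x (fun y => b (f y) (g y)) (fun v => b ('d f x v) (g x) + b (f x) ('d g x v)).
Proof.
move=> df dg.
have cb := @bilinear_mx_continuous R m n p q W b.
have dfg := differentiable_pair df dg.
have db := differentiable_bilin (f x, g x) cb.
have bE : (fun y => b (f y) (g y)) =
  (fun z => b z.1 z.2) \o (fun y => (f y, g y)) by [].
split; first by rewrite bE; exact: differentiable_comp.
rewrite bE diff_comp // (diff_bilin _ cb) diff_pair //.
by apply/funext => v; rewrite /= addrC.
Qed.

Lemma derive_bilinear (R : realType) (V : normedModType R) m n p q
    (W : normedModType R) (b : {bilinear 'M[R]_(m, n) -> 'M[R]_(p, q) -> W})
    (f : V -> 'M[R]_(m, n)) (g : V -> 'M[R]_(p, q)) x v :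
  differentiable f x -> differentiable g x ->
  'D_v (fun y => b (f y) (g y)) x = b ('D_v f x) (g x) + b (f x) ('D_v g x).
Proof.
move=> df dg; have [dfg dfgE] := bilinear_mx_is_diff b df dg.
by rewrite !deriveE // dfgE.
Qed.

Lemma derive_linear (R : realType) (V : normedModType R) m n
    (W : normedModType R) (l : {linear 'M[R]_(m, n) -> W})
    (f : V -> 'M[R]_(m, n)) x v :
  differentiable f x ->
  'D_v (l \o f) x = l ('D_v f x).
Proof.
move=> df; have [dl dlE] := linear_mx_is_diff l (f x).
have dlf : differentiable (l \o f) x by exact: differentiable_comp.
by rewrite (deriveE v dlf) (deriveE v df) (diff_comp df dl) /= dlE.
Qed.

Lemma open_near (T : topologicalType) (U : set T) q :
  open U -> U q -> \forall y \near q, U y.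
Proof. by move=> oU Uq; apply: open_nbhs_nbhs. Qed.

(** Differentiation rules hold only on [U]; each induction on the order of smoothness replaces a
    derivative by its formula through this lemma. Openness turns equality on [U] into equality near
    each point. *)
Lemma Cn_on_ext (R : realType) k (W : normedModType R) m (U : set 'rV[R]_k)
    (f g : 'rV[R]_k -> W) : open U -> (forall q, U q -> f q = g q) ->
  Cn_on m U f -> Cn_on m U g.
Proof.
move=> oU; elim: m f g => [|m IH] f g fg /=;
  have nearfg q : U q -> {near q, f =1 g}
    by move=> Uq; move: (open_near oU Uq); apply: filterS => y /fg.
  move=> cf q Uq; have := cf q Uq; rewrite /prop_for /continuous_at fg //.
  by apply: cvg_trans; apply: (@near_eq_cvg _ _ (nbhs q)); exact: nearfg.
move=> [df cdf]; split=> [q Uq|v].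
  by have [] := near_eq_is_diff (nearfg q Uq) (df q Uq).
apply: IH (cdf v) => q Uq; exact: near_eq_derive (nearfg q Uq).
Qed.

Lemma smooth_differentiable (R : realType) k (W : normedModType R)
    (U : set 'rV[R]_k) (f : 'rV[R]_k -> W) q :
  smooth_on U f -> U q -> differentiable f q.
Proof. by move=> /(_ 1%N)[+ _]; apply. Qed.

Lemma smooth_derive (R : realType) k (W : normedModType R)
    (U : set 'rV[R]_k) (f : 'rV[R]_k -> W) v :
  smooth_on U f -> smooth_on U (fun q => 'D_v f q).
Proof. by move=> sf m; have [_] := sf m.+1; apply. Qed.

Lemma smooth_continuous (R : realType) k (W : normedModType R)
    (U : set 'rV[R]_k) (f : 'rV[R]_k -> W) q :
  smooth_on U f -> U q -> {for q, continuous f}.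
Proof. by move=> /(_ 0%N); apply. Qed.

Lemma Cn_onD (R : realType) k (W : normedModType R) m (U : set 'rV[R]_k)
    (f g : 'rV[R]_k -> W) : open U ->
  Cn_on m U f -> Cn_on m U g -> Cn_on m U (fun q => f q + g q).
Proof.
move=> oU; elim: m f g => [|m IH] f g.
  by move=> cf cg q Uq; apply: continuousD; [exact: cf|exact: cg].
move=> [df cf] [dg cg].
split=> [q Uq|v]; first exact: (differentiableD (df q Uq) (dg q Uq)).
apply: Cn_on_ext oU _ (IH _ _ (cf v) (cg v)) => q Uq.
by rewrite -deriveD //; apply: diff_derivable; [exact: df|exact: dg].
Qed.

Lemma smoothD (R : realType) k (W : normedModType R) (U : set 'rV[R]_k)
    (f g : 'rV[R]_k -> W) : open U ->
  smooth_on U f -> smooth_on U g -> smooth_on U (fun q => f q + g q).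
Proof. by move=> oU sf sg m; apply: Cn_onD. Qed.

Lemma smooth_linear (R : realType) k a b (W : normedModType R) (U : set 'rV[R]_k)
    (l : {linear 'M[R]_(a, b) -> W}) (f : 'rV[R]_k -> 'M[R]_(a, b)) : open U ->
  smooth_on U f -> smooth_on U (l \o f).
Proof.
move=> oU + m; elim: m f => [|m IH] f sf.
  move=> q Uq; apply: continuous_comp; first exact: smooth_continuous sf Uq.
  exact: linear_mx_continuous.
have df q := @smooth_differentiable _ _ _ _ _ q sf.
split=> [q Uq|v].
  have [dl _] := linear_mx_is_diff l (f q).
  by apply: differentiable_comp => //; exact: df.
apply: Cn_on_ext oU _ (IH _ (smooth_derive v sf)) => q Uq /=.
by rewrite derive_linear //; exact: df.
Qed.

(** The Leibniz rule yields two terms of the same shape, so the induction on the order keeps both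
    factors general. *)
Lemma smooth_bilinear (R : realType) k m n p q (W : normedModType R)
    (U : set 'rV[R]_k) (b : {bilinear 'M[R]_(m, n) -> 'M[R]_(p, q) -> W})
    (f : 'rV[R]_k -> 'M[R]_(m, n)) (g : 'rV[R]_k -> 'M[R]_(p, q)) : open U ->
  smooth_on U f -> smooth_on U g -> smooth_on U (fun y => b (f y) (g y)).
Proof.
move=> oU + + s; elim: s f g => [|s IH] f g sf sg.
  move=> y Uy; apply: differentiable_continuous.
  have df := smooth_differentiable sf Uy; have dg := smooth_differentiable sg Uy.
  by have [] := bilinear_mx_is_diff b df dg.
have df y := @smooth_differentiable _ _ _ _ _ y sf.
have dg y := @smooth_differentiable _ _ _ _ _ y sg.
split=> [y Uy|v].
  by have [] := bilinear_mx_is_diff b (df y Uy) (dg y Uy).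
apply: Cn_on_ext oU _ (Cn_onD oU (IH _ _ (smooth_derive v sf) sg)
                                 (IH _ _ sf (smooth_derive v sg))) => y Uy.
by rewrite derive_bilinear //; [exact: df|exact: dg].
Qed.

Lemma smooth_precomp (R : realType) k l (W : normedModType R) (U : set 'rV[R]_k)
    (h : {linear 'rV[R]_l -> 'rV[R]_k}) (f : 'rV[R]_k -> W) : open U ->
  smooth_on U f -> smooth_on (h @^-1` U) (f \o h).
Proof.
move=> oU + m; have oV : open (h @^-1` U).
  by apply: open_comp => // x _; exact: linear_mx_continuous.
elim: m f => [|m IH] f sf.
  move=> q Uq; apply: continuous_comp; first exact: linear_mx_continuous.
  exact: smooth_continuous sf Uq.
have df q := @smooth_differentiable _ _ _ _ _ q sf.
split=> [q Uq|v].
  have [dl _] := linear_mx_is_diff h q.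
  by apply: differentiable_comp => //; exact: df.
apply: Cn_on_ext oV _ (IH _ (smooth_derive (h v) sf)) => q Uq /=.
have [dl dlE] := linear_mx_is_diff h q.
have dfq := df _ Uq; have dfh : differentiable (f \o h) q.
  exact: differentiable_comp.
by rewrite (deriveE v dfh) (deriveE _ dfq) (diff_comp dl dfq) /= dlE.
Qed.

(** * Symmetry of second derivatives *)

Lemma is_derive_line (R : realType) (V W : normedModType R) (g : V -> W)
    (p u : V) (t : R) : differentiable g (t *: u + p) ->
  is_derive t 1 (fun s => g (s *: u + p)) ('D_u g (t *: u + p)).
Proof.
move=> dg.
have dh : is_diff t (fun s : R => s *: u + p) (fun s : R => s *: u + 0).
  exact: (@is_diffD _ _ _ (fun s : R => s *: u) (cst p) _ (cst 0)).
have [dh1 dh2] := dh.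
have dgh : differentiable (g \o (fun s : R => s *: u + p)) t.
  exact: differentiable_comp.
split; first exact: diff_derivable.
by rewrite (deriveE _ dgh) (deriveE u dg) diff_comp //= dh2 scale1r addr0.
Qed.

(** The mean value theorem is applied along [u] to the increment in the direction [v], then along
    [v] to the derivative in the direction [u]. The left side is symmetric in [u] and [v], which
    forces the mixed derivatives to agree. *)
Lemma second_difference (R : realType) k (U : set 'rV[R]_k) (g : 'rV[R]_k -> R)
    (q u v : 'rV[R]_k) (s : R) : 0 < s -> smooth_on U g ->
  (forall a b : R, 0 <= a <= s -> 0 <= b <= s -> U (a *: u + (b *: v + q))) ->
  exists a b : R, [/\ 0 <= a <= s, 0 <= b <= s &
    g (s *: u + (s *: v + q)) - g (s *: u + q) - (g (s *: v + q) - g q) =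
    'D_v (fun y => 'D_u g y) (a *: u + (b *: v + q)) * s * s].
Proof.
move=> s0 sg sU.
have dg a b : 0 <= a <= s -> 0 <= b <= s ->
    differentiable g (a *: u + (b *: v + q)).
  by move=> ha hb; apply: smooth_differentiable sg _; exact: sU.
have dDg a b : 0 <= a <= s -> 0 <= b <= s ->
    differentiable (fun y => 'D_u g y) (b *: v + (a *: u + q)).
  move=> ha hb; apply: smooth_differentiable (smooth_derive u sg) _.
  by rewrite addrCA; exact: sU.
have ss : 0 <= s <= s by rewrite lexx ltW.
have z0 : 0 <= (0 : R) <= s by rewrite lexx ltW.
pose G t := g (t *: u + (s *: v + q)) - g (t *: u + q).
have dG t : 0 <= t <= s -> is_derive t 1 G
    ('D_u g (t *: u + (s *: v + q)) - 'D_u g (t *: u + q)).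
  move=> ht; apply: is_deriveB; apply: is_derive_line; first exact: dg.
  by have := dg t 0 ht z0; rewrite scale0r add0r.
have itv01 t : t \in `]0, s[ -> 0 <= t <= s.
  by rewrite in_itv /= => /andP[/ltW -> /ltW ->].
have [|a /itv01 ha] := MVT s0 (fun t ht => dG t (itv01 t ht)).
  apply: continuous_in_subspaceT => t; rewrite inE /= in_itv /= => ht.
  by apply: differentiable_continuous; apply/derivable1_diffP; have [] := dG t ht.
rewrite subr0 /G !scale0r !add0r => GE.
pose H t := 'D_u g (t *: v + (a *: u + q)).
have dH t : 0 <= t <= s -> is_derive t 1 H
    ('D_v (fun y => 'D_u g y) (t *: v + (a *: u + q))).
  by move=> ht; apply: (is_derive_line (g := fun y => 'D_u g y)); exact: dDg.
have [|b /itv01 hb] := MVT s0 (fun t ht => dH t (itv01 t ht)).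
  apply: continuous_in_subspaceT => t; rewrite inE /= in_itv /= => ht.
  by apply: differentiable_continuous; apply/derivable1_diffP; have [] := dH t ht.
rewrite subr0 /H scale0r add0r => HE.
exists a, b; split=> //.
by rewrite GE [a *: u + (s *: v + q)]addrCA HE [a *: u + (b *: v + q)]addrCA.
Qed.

(** The mean value points are unknown and differ for the two orders of differentiation; since they
    lie in arbitrarily small parallelograms at [q], continuity at [q] is enough to compare the
    limits. *)
Lemma eq_of_close_values (R : realType) k (U : set 'rV[R]_k)
    (A B : 'rV[R]_k -> R) (q u v : 'rV[R]_k) : open U -> U q ->
  {for q, continuous A} -> {for q, continuous B} ->
  (forall s : R, 0 < s ->
    (forall a b : R, 0 <= a <= s -> 0 <= b <= s -> U (a *: u + (b *: v + q))) ->
    exists a b a' b' : R, [/\ 0 <= a <= s, 0 <= b <= s, 0 <= a' <= s, 0 <= b' <= s &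
      A (a *: u + (b *: v + q)) = B (a' *: u + (b' *: v + q))]) ->
  A q = B q.
Proof.
move=> oU Uq cA cB AB.
apply/eqP; rewrite -subr_eq0 -normr_le0 leNgt; apply/negP => AB0.
pose e := `|A q - B q| / 2; have e0 : 0 < e by rewrite divr_gt0.
have /cvgrPdist_lt /(_ _ e0) nA := cA.
have /cvgrPdist_lt /(_ _ e0) nB := cB.
have /nbhs_ballP[d /= d0 dP] : nbhs q [set y |
    [/\ `|A q - A y| < e, `|B q - B y| < e & U y]].
  by near=> y; split; near: y; [exact: nA|exact: nB|exact: (open_near oU Uq)].
(* The summand 1 makes [M] positive and places the parallelogram strictly inside the ball of radius
   [d]. *)
pose M := `|u| + `|v| + 1.
have M0 : 0 < M by rewrite ltr_wpDl // addr_ge0.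
pose s := d / M; have s0 : 0 < s by rewrite divr_gt0.
have inP a b : 0 <= a <= s -> 0 <= b <= s ->
    ball q d (a *: u + (b *: v + q)).
  move=> /andP[a0 ls] /andP[b0 lb].
  rewrite -ball_normE /ball_ /= distrC addrA addrK.
  apply: le_lt_trans (ler_normD _ _) _; rewrite !normrZ !ger0_norm //.
  have : a * `|u| + b * `|v| <= s * (`|u| + `|v|).
    by rewrite mulrDr lerD // ler_wpM2r.
  move=> /le_lt_trans; apply.
  by rewrite /s -mulrA gtr_pMr // mulrC ltr_pdivrMr // mul1r /M ltrDl.
have [|a [b [a' [b' [ha hb ha' hb' E]]]]] := AB s s0.
  by move=> a b ha hb; have [] := dP _ (inP a b ha hb).
have [h1 _ _] := dP _ (inP _ _ ha hb); rewrite E in h1.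
have [_ h2 _] := dP _ (inP _ _ ha' hb').
have : `|A q - B q| < e + e.
  rewrite -(subrKA (B (a' *: u + (b' *: v + q)))).
  apply: le_lt_trans (ler_normD _ _) _; apply: ltrD => //.
  by rewrite distrC.
by rewrite /e -splitr ltxx.
Unshelve. all: by end_near. Qed.

Lemma schwarz_scalar (R : realType) k (U : set 'rV[R]_k) (g : 'rV[R]_k -> R)
    (q u v : 'rV[R]_k) : open U -> smooth_on U g -> U q ->
  'D_v (fun y => 'D_u g y) q = 'D_u (fun y => 'D_v g y) q.
Proof.
move=> oU sg Uq.
have cA := smooth_continuous (smooth_derive v (smooth_derive u sg)) Uq.
have cB := smooth_continuous (smooth_derive u (smooth_derive v sg)) Uq.
apply: (eq_of_close_values (u := u) (v := v) oU Uq cA cB) => s s0 inU.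
have inU' a b : 0 <= a <= s -> 0 <= b <= s -> U (a *: v + (b *: u + q)).
  by move=> ha hb; rewrite addrCA; exact: inU.
have [a [b [ha hb E1]]] := second_difference s0 sg inU.
have [a' [b' [ha' hb' E2]]] := second_difference s0 sg inU'.
(* The second expansion exchanges the roles of [u] and [v], hence [b'] precedes [a']. *)
exists a, b, b', a'; constructor; [exact: ha|exact: hb|exact: hb'|exact: ha'|].
rewrite [s *: v + (s *: u + q)]addrCA [a' *: v + (b' *: u + q)]addrCA in E2.
move: E1 E2.
move: ('D_v _ _) ('D_u _ _) => X Y E1 E2.
apply: (mulIf (lt0r_neq0 s0)); apply: (mulIf (lt0r_neq0 s0)).
by rewrite -E1 -E2; ring.
Qed.

(** Coordinates as linear maps, so that [derive_linear] lets them commute with derivatives. *)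
Definition entry (R : realType) m n (i : 'I_m) (j : 'I_n) (M : 'M[R]_(m, n)) : R :=
  M i j.

Lemma entry_is_linear (R : realType) m n (i : 'I_m) (j : 'I_n) :
  linear (@entry R m n i j).
Proof. by move=> c A B; rewrite /entry !mxE. Qed.

HB.instance Definition _ (R : realType) m n (i : 'I_m) (j : 'I_n) :=
  GRing.isLinear.Build R 'M[R]_(m, n) R _ (@entry R m n i j)
    (@entry_is_linear R m n i j).

Lemma derive_entry (R : realType) (V : normedModType R) m n
    (f : V -> 'M[R]_(m, n)) x v i j :
  differentiable f x -> 'D_v (entry i j \o f) x = 'D_v f x i j.
Proof. by move=> df; rewrite derive_linear. Qed.

Lemma schwarz (R : realType) k m n (U : set 'rV[R]_k)
    (f : 'rV[R]_k -> 'M[R]_(m, n)) (q u v : 'rV[R]_k) :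
  open U -> smooth_on U f -> U q ->
  'D_v (fun y => 'D_u f y) q = 'D_u (fun y => 'D_v f y) q.
Proof.
move=> oU sf Uq; apply/matrixP => i j.
have E w z : 'D_z (fun y => 'D_w f y) q i j =
             'D_z (fun y => 'D_w (entry i j \o f) y) q.
  have dw := smooth_differentiable (smooth_derive w sf) Uq.
  apply: (eq_trans (esym (derive_entry z i j dw))); apply: near_eq_derive.
  move: (open_near oU Uq); apply: filterS => y Uy.
  exact: (esym (derive_entry w i j (smooth_differentiable sf Uy))).
apply: (eq_trans (E u v)); apply: (eq_trans _ (esym (E v u))).
apply: (schwarz_scalar u v oU _ Uq); exact: smooth_linear.
Qed.

(** * Charts of submanifolds *)

(** The differentiability half of the inverse function theorem, with continuity of [z] already
    known. The remainder estimate of [phi] with constant 1/2 makes [z] Lipschitz at [x]; the same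
    estimate with a small constant then bounds the error. *)
Lemma is_diff_inverse (R : realType) (V W : normedModType R)
    (phi : W -> W) (z gam : V -> W) (x : V) :
  {for x, continuous z} -> is_diff (z x) phi id -> differentiable gam x ->
  (\forall y \near x, phi (z y) = gam y) -> is_diff x z ('d gam x).
Proof.
move=> cz [dphi phiE] dgam phiz.
have cgam := diff_continuous dgam.
have [C C0 gamC] := linear_lipschitz cgam.
apply: is_diff_near => // e e0.
pose C1 := C + 1; have C10 : 0 < C1 by rewrite addr_gt0.
(* Chosen so that [e1] times the Lipschitz constant [2 * C1] of [z] is [e / 2]. *)
pose e1 := e / (4 * C1); have e10 : 0 < e1 by rewrite divr_gt0 // mulr_gt0.
have half0 : 0 < 2^-1 :> R by rewrite invr_gt0.
have e20 : 0 < e / 2 by rewrite divr_gt0.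
have n1 := differentiable_nearP dgam ltr01.
have n2 := differentiable_nearP dgam e20.
have := differentiable_nearP dphi half0; rewrite phiE => /cz n3.
have := differentiable_nearP dphi e10; rewrite phiE => /cz n4.
rewrite /= in n3 n4.
have zgam := nbhs_singleton phiz.
near=> y.
have h0 : phi (z y) = gam y by near: y.
have h1 : `|gam y - gam x - 'd gam x (y - x)| <= 1 * `|y - x| by near: y.
have h2 : `|gam y - gam x - 'd gam x (y - x)| <= e / 2 * `|y - x| by near: y.
have h3 : `|phi (z y) - phi (z x) - (z y - z x)| <= 2^-1 * `|z y - z x| by near: y.
have h4 : `|phi (z y) - phi (z x) - (z y - z x)| <= e1 * `|z y - z x| by near: y.
rewrite h0 zgam in h3 h4.
have b1 : `|gam y - gam x| <= C1 * `|y - x|.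
  rewrite -[gam y - gam x](subrK ('d gam x (y - x))).
  apply: le_trans (ler_normD _ _) _; rewrite /C1 mulrDl addrC.
  by apply: lerD => //; exact: gamC.
have b2 : `|z y - z x| <= 2 * C1 * `|y - x|.
  have : `|z y - z x| <= `|gam y - gam x| + 2^-1 * `|z y - z x|.
    rewrite -[X in `|X| <= _](subKr (gam y - gam x)).
    apply: le_trans (ler_normB _ _) _; exact: lerD.
  by move: b1; set a := `|z y - z x|; set b := `|gam y - gam x|; lra.
rewrite -[z y - z x](subKr (gam y - gam x)) addrAC.
apply: le_trans (ler_normB _ _) _.
have b3 : e1 * `|z y - z x| <= e / 2 * `|y - x|.
  apply: le_trans (ler_wpM2l (ltW e10) b2) _.
  rewrite mulrA ler_wpM2r // /e1 le_eqVlt; apply/orP; left; apply/eqP.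
  by field; rewrite gt_eqF.
rewrite [e]splitr mulrDl; apply: lerD => //.
exact: le_trans h4 b3.
Unshelve. all: by end_near. Qed.

Lemma param_mem (R : realType) k n (M : set 'rV[R]_n) U (f : 'rV[R]_k -> 'rV[R]_n) q :
  local_param M U f -> U q -> M (f q).
Proof.
move=> [oU _ _ _ hf] Uq; have [Om _ UOm] := hf U oU (@subset_refl _ U).
have : (f @` U) (f q) by exists q.
by rewrite UOm => -[].
Qed.

Lemma param_row_free (R : realType) k n (M : set 'rV[R]_n) U
    (f : 'rV[R]_k -> 'rV[R]_n) q :
  local_param M U f -> U q -> row_free (jacobian f q).
Proof.
move=> [_ sf imm _ _] Uq; have df := smooth_differentiable sf Uq.
apply: inj_row_free => v vJ; apply: (imm q v Uq).
by rewrite deriveEjacobian.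
Qed.

Lemma push_frameE (R : realType) k n l (f : 'rV[R]_k -> 'rV[R]_n) q (A : 'M[R]_(l, k)) :
  differentiable f q -> push_frame f q A = A *m jacobian f q.
Proof.
move=> df; apply/row_matrixP => i; rewrite rowK row_mul.
exact: deriveEjacobian.
Qed.

(** Relative openness of the image of [U] intersected with [N]: points of [M] near [f q] have
    parameters near [q]. This gives continuity of the transition map. *)
Lemma param_near (R : realType) k n (M : set 'rV[R]_n) U (f : 'rV[R]_k -> 'rV[R]_n)
    V (g : 'rV[R]_k -> 'rV[R]_n) q q' :
  local_param M U f -> local_param M V g -> U q -> V q' -> f q = g q' ->
  forall N : set 'rV[R]_k, nbhs q N ->
  \forall y \near q', exists2 x, (U `&` N) x & f x = g y.
Proof.
move=> pf pg Uq Vq' fg N' nN.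
have [oU _ _ _ hf] := pf.
pose N := U `&` N'°.
have oN : open N by apply: openI => //; exact: open_interior.
have [Om oOm NOm] := hf N oN (@subIsetl _ U _).
have Ogq : Om (g q').
  have : (f @` N) (f q) by exists q => //; split=> //; exact: nN.
  by rewrite NOm -fg => -[].
have cg : {for q', continuous g}.
  by have [_ sg _ _ _] := pg; exact: smooth_continuous sg Vq'.
have nO : \forall y \near q', Om (g y) by apply: cg; exact: (open_near oOm Ogq).
have oV : open V by have [] := pg.
move: nO (open_near oV Vq'); apply: filterS2 => y Oy Vy.
have : (f @` N) (g y) by rewrite NOm; split=> //; exact: param_mem pg Vy.
move=> [x [Ux Nx] fx]; exists x => //; split=> //.
exact: (@interior_subset _ N').
Qed.

(* The transition map between two charts is differentiable: it is continuous,
   and a linear left inverse of df(q) makes it a local inverse of a map whose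
   derivative is the identity. *)
Lemma chart_transition (R : realType) k n (M : set 'rV[R]_n) U
    (f : 'rV[R]_k -> 'rV[R]_n) V (g : 'rV[R]_k -> 'rV[R]_n) q q' :
  local_param M U f -> local_param M V g -> U q -> V q' -> f q = g q' ->
  exists T : 'M[R]_k, forall (W : normedModType R) (h : 'rV[R]_n -> W) w,
    differentiable (h \o f) q -> 'D_w (h \o g) q' = 'D_(w *m T) (h \o f) q.
Proof.
move=> pf pg Uq Vq' fg.
have [oU sf imm injf hf] := pf; have [oV sg _ _ _] := pg.
have df := smooth_differentiable sf Uq; have dg := smooth_differentiable sg Vq'.
have /row_freeP [P JP] := param_row_free pf Uq.
(* The transition map from [g] to [f]. The default [q] is taken only where [g y] is outside the
   image of [f], which does not happen near [q']. *)
pose z y := xget q [set x | U x /\ f x = g y].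
have zE x y : U x -> f x = g y -> z y = x.
  move=> Ux fx; have [Uz fz] : [set x | U x /\ f x = g y] (z y).
    by apply: xgetPex; exists x.
  by apply: injf => //; rewrite fz.
have zq : z q' = q by exact: zE.
have near_z := param_near pf pg Uq Vq' fg.
have cz : {for q', continuous z}.
  move=> N; rewrite zq => nN; move: (near_z N nN).
  by apply: filterS => y [x [Ux Nx] fx] /=; rewrite (zE x y).
have fz : \forall y \near q', f (z y) = g y.
  have nT : nbhs q [set: 'rV[R]_k] by exact: filterT.
  move: (near_z _ nT); apply: filterS => y [x [Ux _] fx].
  by rewrite (zE x y).
pose l : {linear 'rV[R]_n -> 'rV[R]_k} := mulmxr P.
have [dl dlE] := linear_mx_is_diff l (f q).
have [dl' dlE'] := linear_mx_is_diff l (g q').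
have dphi : is_diff (z q') (l \o f) id.
  rewrite zq; split; first exact: differentiable_comp.
  rewrite (diff_comp df dl) dlE; apply/funext => v /=.
  have := deriveE v df; rewrite deriveEjacobian // => <-.
  by rewrite -mulmxA JP mulmx1.
have dgam : differentiable (l \o g) q' by exact: differentiable_comp.
have lfz : \forall y \near q', (l \o f) (z y) = (l \o g) y.
  by move: fz; apply: filterS => y /= ->.
have [dz dzE] := is_diff_inverse cz dphi dgam lfz.
(* One matrix serves every [h]: [h = id] compares tangent vectors, other [h] compare derivatives of
   functions on [M]. Their agreement makes [deriv_along] well defined. *)
exists (lin1_mx ('d (l \o g) q')) => W h w dhf.
have dhf' : differentiable (h \o f) (z q') by rewrite zq; exact: dhf.
have dhfz := differentiable_comp dz dhf'.
have hfz : {near q', (h \o f) \o z =1 h \o g}.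
  by move: fz; apply: filterS => y /= ->.
have E : 'D_w ((h \o f) \o z) q' = 'D_w (h \o g) q' by exact: near_eq_derive.
apply: (eq_trans (esym E)).
apply: (eq_trans (deriveE w dhfz)); apply: (eq_trans _ (esym (deriveE _ dhf))).
have E2 : w *m lin1_mx ('d (l \o g) q') = 'd z q' w.
  have E0 := mul_rV_lin1 ('d (l \o g) q') w; apply: (eq_trans E0).
  exact: (esym (congr1 (fun F : 'rV[R]_k -> 'rV[R]_k => F w) dzE)).
have E3 : 'd (h \o f) (z q') = 'd (h \o f) q by rewrite zq.
apply: (eq_trans (congr1 (fun F : _ -> W => F w) (diff_comp dz dhf'))).
apply: (eq_trans _ (congr1 _ (esym E2))).
exact: (congr1 (fun F : {linear _ -> _} => F _) E3).
Qed.

Lemma param_differentiable (R : realType) k n (M : set 'rV[R]_n) U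
    (f : 'rV[R]_k -> 'rV[R]_n) q :
  local_param M U f -> U q -> differentiable f q.
Proof. by move=> [_ sf _ _ _] Uq; exact: smooth_differentiable sf Uq. Qed.

Lemma chart_jacobian (R : realType) k n (M : set 'rV[R]_n) U
    (f : 'rV[R]_k -> 'rV[R]_n) V (g : 'rV[R]_k -> 'rV[R]_n) q q' :
  local_param M U f -> local_param M V g -> U q -> V q' -> f q = g q' ->
  exists2 T : 'M[R]_k, jacobian g q' = T *m jacobian f q & T \in unitmx.
Proof.
move=> pf pg Uq Vq' fg.
have df := param_differentiable pf Uq.
have dg := param_differentiable pg Vq'.
have [T TE] := chart_transition pf pg Uq Vq' fg.
have JE : jacobian g q' = T *m jacobian f q.
  apply/row_matrixP => i.
  have E := TE _ id (delta_mx 0 i) df.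
  rewrite row_mul [row i T]rowE [row i _]rowE.
  apply: (eq_trans (esym (deriveEjacobian _ dg))).
  exact: (eq_trans E (deriveEjacobian _ df)).
exists T => //; rewrite -row_free_unit -kermx_eq0.
have := param_row_free pg Vq'; rewrite -kermx_eq0 JE => /eqP K0.
apply/eqP; apply/row_matrixP => i; rewrite row0.
have : row i (kermx T) *m (T *m jacobian f q) = 0.
  by rewrite mulmxA -row_mul mulmx_ker row0 mul0mx.
by move=> /eqP; rewrite -sub_kermx K0 => /submx0null.
Qed.

Lemma tangentE (R : realType) k n (M : set 'rV[R]_n) U
    (f : 'rV[R]_k -> 'rV[R]_n) q v : local_param M U f -> U q ->
  tangent k M (f q) v <-> exists w, v = w *m jacobian f q.
Proof.
move=> pf Uq; split.
  move=> [V [g [q' [w [pg Vq' gf <-]]]]].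
  have [T JE _] := chart_jacobian pf pg Uq Vq' (esym gf).
  have dg := param_differentiable pg Vq'.
  exists (w *m T); rewrite -mulmxA -JE; exact: deriveEjacobian.
move=> [w ->]; exists U, f, q, w; split=> //.
have df := param_differentiable pf Uq.
exact: deriveEjacobian.
Qed.

Lemma tangent_rowsP (R : realType) k l n (M : set 'rV[R]_n) U
    (f : 'rV[R]_k -> 'rV[R]_n) q (B : 'M[R]_(l, n)) : local_param M U f -> U q ->
  (forall i, tangent k M (f q) (row i B)) <-> exists A, B = A *m jacobian f q.
Proof.
move=> pf Uq; split=> [tB|[A ->] i]; last first.
  by apply/(tangentE _ pf Uq); exists (row i A); rewrite row_mul.
have [w wE] := boolp.choice (fun i => (tangentE _ pf Uq).1 (tB i)).
by exists (\matrix_i w i); apply/row_matrixP => i; rewrite row_mul rowK.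
Qed.

(** The value picked by [xget] comes from some chart [g] and direction [w']; the transition matrix
    sends [w'] to [w] because df(q) is injective. *)
Lemma deriv_alongE (R : realType) k n (M : set 'rV[R]_n) (W : normedModType R)
    (h : 'rV[R]_n -> W) U (f : 'rV[R]_k -> 'rV[R]_n) q w :
  local_param M U f -> U q -> differentiable (h \o f) q ->
  deriv_along k M h (f q) (w *m jacobian f q) = 'D_w (h \o f) q.
Proof.
move=> pf Uq dhf.
have df := param_differentiable pf Uq.
rewrite /deriv_along; set S := [set d | _].
have [V [g [q' [w' [pg Vq' gf wE ->]]]]] : S (xget 0 S).
  apply: xgetPex; exists ('D_w (h \o f) q), U, f, q, w; split=> //.
  exact: deriveEjacobian.
have [T TE] := chart_transition pf pg Uq Vq' (esym gf).
apply: (eq_trans (TE W h w' dhf)).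
suff -> : w' *m T = w by [].
have E := eq_trans (esym (TE _ id w' df)) wE.
have E' := eq_trans (esym (deriveEjacobian _ df)) E.
exact: (row_free_inj (param_row_free pf Uq) E').
Qed.

Lemma param_onb (R : realType) k n (M : set 'rV[R]_n) U
    (f : 'rV[R]_k -> 'rV[R]_n) q : local_param M U f -> U q ->
  exists2 A : 'M[R]_k, 0 < \det A &
    (A *m jacobian f q) *m (A *m jacobian f q)^T = 1%:M.
Proof. by move=> pf Uq; apply: gram_schmidt; exact: param_row_free pf Uq. Qed.

(** * The parametrization of X_sigma *)

Lemma asd_wedge_coords (R : realType) (u v : 'rV[R]_4) :
  asd_wedge u v = \row_k nth 0 [::
    u 0 0 * v 0 1 - u 0 1 * v 0 0 - (u 0 2 * v 0 3 - u 0 3 * v 0 2);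
    u 0 0 * v 0 2 - u 0 2 * v 0 0 - (u 0 3 * v 0 1 - u 0 1 * v 0 3);
    u 0 0 * v 0 3 - u 0 3 * v 0 0 - (u 0 1 * v 0 2 - u 0 2 * v 0 1)] k.
Proof.
apply/rowP => k; rewrite mxE [RHS]mxE.
have -> : (u *m asd_form (delta_mx 0 k) *m v^T) 0 0 =
          \sum_j (\sum_i u 0 i * asd_form (delta_mx 0 k) i j) * v 0 j.
  by rewrite mxE; apply: eq_bigr => j _; rewrite mxE [v^T _ _]mxE.
rewrite !sum4E !asd_formE /= !mxE.
by elim/ord3_ind: k => /=; ring.
Qed.

Lemma asd_wedge_is_bilinear (R : realType) :
  bilinear_for (GRing.Scale.Law.clone _ _ *:%R _) (GRing.Scale.Law.clone _ _ *:%R _)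
    (@asd_wedge R).
Proof.
by split=> [v|u] c a b /=; rewrite !asd_wedge_coords; apply/rowP => k;
  rewrite !mxE; elim/ord3_ind: k => /=; ring.
Qed.

HB.instance Definition _ (R : realType) :=
  bilinear_isBilinear.Build R 'rV[R]_4 'rV[R]_4 'rV[R]_3 _ _ (@asd_wedge R)
    (@asd_wedge_is_bilinear R).

Lemma asd_coef_is_linear (R : realType) : linear (@asd_coef R).
Proof. by move=> c a b; rewrite asd_coefD asd_coefZ. Qed.

HB.instance Definition _ (R : realType) :=
  GRing.isLinear.Build R 'M[R]_4 'rV[R]_3 _ (@asd_coef R) (@asd_coef_is_linear R).

Definition asd_rows (R : realType) (P : 'M[R]_(2, 4)) : 'rV[R]_3 :=
  asd_wedge (row 0 P) (row 1 P).

(** Up to a determinant, only the plane spanned by the rows matters; hence any tangent frame of L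
    yields a generator of E. *)
Lemma asd_rows_mull (R : realType) (A : 'M[R]_2) (P : 'M[R]_(2, 4)) :
  asd_rows (A *m P) = \det A *: asd_rows P.
Proof.
have AE i j : (A *m P) i j = A i 0 * P 0 j + A i 1 * P 1 j.
  rewrite mxE !big_ord_recl big_ord0 addr0.
  by congr (A _ _ * P _ _ + A _ _ * P _ _); apply/val_inj.
rewrite /asd_rows !asd_wedge_coords det2E; apply/rowP => k.
rewrite [LHS]mxE [RHS]mxE [X in _ = _ * X]mxE ![row _ _ _ _]mxE !AE.
by elim/ord3_ind: k => /=; ring.
Qed.

Lemma usubmx_rows (R : realType) (e : 'M[R]_4) :
  row 0 (usubmx (e : 'M[R]_(2 + 2, 4))) = row 0 e /\
  row 1 (usubmx (e : 'M[R]_(2 + 2, 4))) = row 1 e.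
Proof.
by split; apply/rowP => j; rewrite !mxE; congr (e _ _); apply/val_inj.
Qed.

(** The coordinates of the left side in the frame omega^1, omega^2, omega^3 are the values
    omega^i(e_1, e_2), namely 1, 0, 0. *)
Lemma asd_rows_frame (R : realType) (e : 'M[R]_4) :
  e *m e^T = 1%:M -> \det e = 1 ->
  asd_form (asd_rows (usubmx (e : 'M[R]_(2 + 2, 4)))) = omega1 e.
Proof.
move=> ee de; have [C [CC dC [C0 C1 C2]]] := asd_frame ee de.
have [w1 w2 w3] := omega_on_frame ee.
rewrite -C0; congr asd_form; rewrite /asd_rows.
have [-> ->] := usubmx_rows e.
rewrite -[LHS]mulmx1 -(mulmx1C CC) mulmxA [RHS]rowE; congr (_ *m C).
apply/rowP => k; rewrite mulmx_trE (_ : row 0 _ = asd_wedge (row 0 e) (row 1 e)).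
  by rewrite asd_wedgeE mxE; elim/ord3_ind: k; rewrite ?C0 ?C1 ?C2.
by apply/rowP => j; rewrite mxE.
Qed.

Lemma exists_adapted_frame (R : realType) (L : set 'rV[R]_4)
    (o : 'rV[R]_4 -> 'M[R]_(2, 4) -> Prop) p :
  orients L o -> L p -> exists e, adapted_frame L o p e.
Proof.
move=> oL Lp; have [U [f [pf [q Uq <-] fo]]] := oL p Lp.
have df := param_differentiable pf Uq.
have [A dA AA] := param_onb pf Uq.
have [e [ee de eE]] := extend_SO4 AA.
exists e; split=> //; split; rewrite eE //.
  by apply/(tangent_rowsP _ pf Uq); exists A.
by rewrite -push_frameE //; apply/fo.
Qed.

(** As E is a line, its generator may come from any tangent frame, of either orientation and
    unnormalized; the inclusion from right to left rests on the existence of an adapted frame. *)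
Lemma E_fibreE (R : realType) (L : set 'rV[R]_4)
    (o : 'rV[R]_4 -> 'M[R]_(2, 4) -> Prop) U f q (A : 'M[R]_2) eta :
  orients L o -> local_param L U f -> U q -> A \in unitmx ->
  E_fibre L o (f q) eta <->
  exists r, eta = r *: asd_form (asd_rows (A *m jacobian f q)).
Proof.
move=> oL pf Uq uA.
have key e : adapted_frame L o (f q) e -> exists2 c, c != 0 &
    omega1 e = c *: asd_form (asd_rows (A *m jacobian f q)).
  move=> [ee de [te oe _]].
  have [B BE] := (tangent_rowsP _ pf Uq).1 te.
  rewrite -(asd_rows_frame ee de) BE asd_rows_mull asd_rows_mull !asd_formZ.
  exists (\det B / \det A); last first.
    by rewrite scalerA mulfVK // -unitfE -unitmxE.
  rewrite mulf_neq0 ?invr_neq0 // -unitfE -unitmxE //.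
  rewrite -row_free_unit; apply/row_freeP.
  by exists (jacobian f q *m (usubmx (e : 'M[R]_(2 + 2, 4)))^T); rewrite mulmxA -BE.
split=> [[e [r [ae ->]]]|[r ->]].
  by have [c _ ->] := key e ae; exists (r * c); rewrite scalerA.
have [e ae] := exists_adapted_frame oL (param_mem pf Uq).
have [c c0 cE] := key e ae.
by exists e, (r / c); split=> //; rewrite cE scalerA mulfVK.
Qed.

Lemma smooth_cst (R : realType) k (W : normedModType R) (U : set 'rV[R]_k) (c : W) :
  open U -> smooth_on U (fun=> c).
Proof.
move=> oU m; elim: m c => [|m IH] c /=; first by move=> q _; exact: cst_continuous.
split=> [q _|v]; first exact: differentiable_cst.
by apply: Cn_on_ext oU _ (IH 0) => q _; rewrite derive_cst.
Qed.

Lemma smooth_id (R : realType) k (U : set 'rV[R]_k) :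
  open U -> smooth_on U (fun q : 'rV[R]_k => q).
Proof.
move=> oU [|m] /=; first by move=> q _; exact: cvg_id.
split=> [q _|v]; first by have [] := is_diff_id q.
by apply: Cn_on_ext oU _ (smooth_cst v oU m) => q _; rewrite derive_id.
Qed.

Lemma derive_precomp (R : realType) k l (W : normedModType R)
    (h : {linear 'rV[R]_l -> 'rV[R]_k}) (f : 'rV[R]_k -> W) z w :
  differentiable f (h z) -> 'D_w (f \o h) z = 'D_(h w) f (h z).
Proof.
move=> dfq; have [dl dlE] := linear_mx_is_diff h z.
have dfh : differentiable (f \o h) z by exact: differentiable_comp.
apply: (eq_trans (deriveE w dfh)); apply: (eq_trans _ (esym (deriveE _ dfq))).
by rewrite (diff_comp dl dfq) /= dlE.
Qed.

Definition asd_field (R : realType) (f : 'rV[R]_2 -> 'rV[R]_4) (A : 'M[R]_2)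
    (q : 'rV[R]_2) : 'rV[R]_3 :=
  asd_wedge ('D_(row 0 A) f q) ('D_(row 1 A) f q).

(* The first two coordinates parametrize the surface, the last one the line
   E_x, through the nowhere vanishing section [asd_field f A]. *)
Definition X_param (R : realType) (f : 'rV[R]_2 -> 'rV[R]_4) (A : 'M[R]_2)
    (sigma : 'rV[R]_4 -> 'M[R]_4) (z : 'rV[R]_(2 + 1)) : 'rV[R]_(4 + 3) :=
  row_mx (f (lsubmx z))
    (rsubmx z *m asd_field f A (lsubmx z) + asd_coef (sigma (f (lsubmx z)))).

Lemma asd_field_rows (R : realType) (f : 'rV[R]_2 -> 'rV[R]_4) A q :
  differentiable f q -> asd_field f A q = asd_rows (A *m jacobian f q).
Proof.
move=> df; rewrite /asd_field /asd_rows !row_mul.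
by congr asd_wedge; exact: deriveEjacobian.
Qed.

Lemma asd_field_neq0 (R : realType) (L : set 'rV[R]_4) U f q (A : 'M[R]_2) :
  local_param L U f -> U q -> A \in unitmx -> asd_field f A q != 0.
Proof.
move=> pf Uq uA; rewrite asd_field_rows; last exact: param_differentiable pf Uq.
have [B dB BB] := param_onb pf Uq.
have [e [ee de eE]] := extend_SO4 BB.
rewrite asd_rows_mull scaler_eq0 negb_or -unitfE -unitmxE uA /=.
apply/eqP => J0.
have om0 : omega1 e = 0.
  rewrite -(asd_rows_frame ee de) eE asd_rows_mull J0 scaler0.
  by rewrite -[0](scale0r 0) asd_formZ scale0r.
have [+ _ _] := omega_on_frame ee.
by rewrite om0 mulmx0 dotv0l => /esym/eqP; rewrite oner_eq0.
Qed.

Lemma asd_field_smooth (R : realType) (U : set 'rV[R]_2) (f : 'rV[R]_2 -> 'rV[R]_4) A :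
  open U -> smooth_on U f -> smooth_on U (asd_field f A).
Proof.
move=> oU sf.
exact: (smooth_bilinear (@asd_wedge R) oU (smooth_derive _ sf) (smooth_derive _ sf)).
Qed.

(** Exhibits the chart as an assembly of linear and bilinear maps, the form to which the rules for
    smoothness and derivatives apply. *)
Lemma X_paramE (R : realType) f (A : 'M[R]_2) sigma :
  X_param f A sigma = (fun z =>
    mulmxr (row_mx (1%:M : 'M[R]_4) (0 : 'M[R]_(4, 3))) ((f \o lsubmx) z) +
    mulmxr (row_mx (0 : 'M[R]_(3, 4)) (1%:M : 'M[R]_3))
      (rsubmx z *m ((asd_field f A) \o lsubmx) z +
       asd_coef (((sigma \o f) \o lsubmx) z))).
Proof.
apply/funext => z; rewrite /X_param /= !mul_mx_row !mulmx1 !mulmx0.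
by rewrite add_row_mx addr0 add0r.
Qed.

Lemma X_memE (R : realType) (L : set 'rV[R]_4)
    (o : 'rV[R]_4 -> 'M[R]_(2, 4) -> Prop) sigma U f q (A : 'M[R]_2) r :
  orients L o -> smooth_section_F L o sigma ->
  local_param L U f -> U q -> A \in unitmx ->
  X_sigma L o sigma (row_mx (f q) r) <->
  exists t : 'rV[R]_1, r = t *m asd_field f A q + asd_coef (sigma (f q)).
Proof.
move=> oL [sF _] pf Uq uA; have Lfq := param_mem pf Uq.
have [asd_s _] := sF _ Lfq.
have Efib := E_fibreE _ oL pf Uq uA.
have fE := asd_field_rows A (param_differentiable pf Uq).
rewrite /X_sigma /= row_mxKl row_mxKr fE; split.
  move=> [_ [eta /Efib[c ->] rE]]; exists c%:M.
  apply: (can_inj (@asd_formK R)).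
  by rewrite rE asd_formD mul_scalar_mx asd_formZ anti_self_dualK.
move=> [t ->]; split=> //.
exists (t 0 0 *: asd_form (asd_rows (A *m 'J f q))); first by apply/Efib; exists (t 0 0).
by rewrite asd_formD anti_self_dualK // {1}[t]mx11_scalar mul_scalar_mx asd_formZ.
Qed.

Lemma differentiable_X_fibre (R : realType) (W : 'rV[R]_2 -> 'rV[R]_3)
    (s : 'rV[R]_2 -> 'M[R]_4) (z w : 'rV[R]_(2 + 1)) :
  differentiable W (lsubmx z) -> differentiable s (lsubmx z) ->
  let g := fun y : 'rV[R]_(2 + 1) =>
    rsubmx y *m (W \o lsubmx) y + asd_coef ((s \o lsubmx) y) in
  differentiable g z /\
  'D_w g z = rsubmx w *m W (lsubmx z) + rsubmx z *m 'D_(lsubmx w) W (lsubmx z)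
    + asd_coef ('D_(lsubmx w) s (lsubmx z)).
Proof.
move=> dW ds g.
pose p : {linear 'rV[R]_(2 + 1) -> 'rV[R]_2} := lsubmx.
pose t : {linear 'rV[R]_(2 + 1) -> 'rV[R]_1} := rsubmx.
pose c : {linear 'M[R]_4 -> 'rV[R]_3} := @asd_coef R.
have [dp _] := linear_mx_is_diff p z.
have [dt dtE] := linear_mx_is_diff t z.
have dWp : differentiable (W \o p) z by exact: differentiable_comp.
have dsp : differentiable (s \o p) z by exact: differentiable_comp.
have [dc _] := linear_mx_is_diff c ((s \o p) z).
have dcs : differentiable (c \o (s \o p)) z by exact: differentiable_comp.
pose b : {bilinear 'rV[R]_1 -> 'rV[R]_3 -> 'rV[R]_3} := @mulmx R 1 1 3.
have [db _] := bilinear_mx_is_diff b dt dWp.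
split; first exact: (differentiableD db dcs).
have E1 := deriveD (diff_derivable (v := w) db) (diff_derivable (v := w) dcs).
apply: (eq_trans E1); congr (_ + _).
  apply: (eq_trans (derive_bilinear b w dt dWp)).
  have -> : 'D_w t z = rsubmx w.
    by apply: (eq_trans (deriveE w dt)); rewrite dtE.
  have -> : 'D_w (W \o p) z = 'D_(lsubmx w) W (lsubmx z) by exact: derive_precomp.
  by [].
apply: (eq_trans (derive_linear c w dsp)).
by congr asd_coef; exact: derive_precomp.
Qed.

Lemma X_param_derive (R : realType) f (A : 'M[R]_2) sigma (z w : 'rV[R]_(2 + 1)) :
  differentiable f (lsubmx z) -> differentiable (asd_field f A) (lsubmx z) ->
  differentiable (sigma \o f) (lsubmx z) ->
  'D_w (X_param f A sigma) z = row_mx ('D_(lsubmx w) f (lsubmx z))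
    (rsubmx w *m asd_field f A (lsubmx z)
     + rsubmx z *m 'D_(lsubmx w) (asd_field f A) (lsubmx z)
     + asd_coef ('D_(lsubmx w) (sigma \o f) (lsubmx z))).
Proof.
move=> df dW ds.
have [dg gE] := differentiable_X_fibre w dW ds.
set g := fun y => _ in dg gE.
pose p : {linear 'rV[R]_(2 + 1) -> 'rV[R]_2} := lsubmx.
have [dp _] := linear_mx_is_diff p z.
have dfp : differentiable (f \o p) z by exact: differentiable_comp.
pose l1 : {linear 'rV[R]_4 -> 'rV[R]_(4 + 3)} :=
  mulmxr (row_mx (1%:M : 'M[R]_4) (0 : 'M[R]_(4, 3))).
pose l2 : {linear 'rV[R]_3 -> 'rV[R]_(4 + 3)} :=
  mulmxr (row_mx (0 : 'M[R]_(3, 4)) (1%:M : 'M[R]_3)).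
have [dl1 _] := linear_mx_is_diff l1 ((f \o p) z).
have [dl2 _] := linear_mx_is_diff l2 (g z).
have d1 : differentiable (l1 \o (f \o p)) z by exact: differentiable_comp.
have d2 : differentiable (l2 \o g) z by exact: differentiable_comp.
rewrite X_paramE.
have E1 := deriveD (diff_derivable (v := w) d1) (diff_derivable (v := w) d2).
apply: (eq_trans E1).
have F1 : 'D_w (l1 \o (f \o p)) z = row_mx ('D_(lsubmx w) f (lsubmx z)) 0.
  apply: (eq_trans (derive_linear l1 w dfp)).
  have -> : 'D_w (f \o p) z = 'D_(lsubmx w) f (lsubmx z) by exact: derive_precomp.
  by rewrite /l1 /= mul_mx_row mulmx1 mulmx0.
have F2 : 'D_w (l2 \o g) z = row_mx 0 ('D_w g z).
  apply: (eq_trans (derive_linear l2 w dg)).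
  by rewrite /l2 /= mul_mx_row mulmx1 mulmx0.
rewrite F1 F2 gE add_row_mx addr0 add0r.
by [].
Qed.

Lemma X_param_smooth (R : realType) (U : set 'rV[R]_2) f (A : 'M[R]_2) sigma :
  open U -> smooth_on U f -> smooth_on U (sigma \o f) ->
  smooth_on (@lsubmx R 1 2 1 @^-1` U) (X_param f A sigma).
Proof.
move=> oU sf ss; rewrite X_paramE.
pose p : {linear 'rV[R]_(2 + 1) -> 'rV[R]_2} := lsubmx.
pose t : {linear 'rV[R]_(2 + 1) -> 'rV[R]_1} := rsubmx.
pose c : {linear 'M[R]_4 -> 'rV[R]_3} := @asd_coef R.
have oV : open (p @^-1` U).
  by apply: open_comp => // x _; exact: linear_mx_continuous.
apply: (smoothD oV).
  exact: (smooth_linear (mulmxr (row_mx (1%:M : 'M[R]_4) (0 : 'M[R]_(4, 3)))) oV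
           (smooth_precomp p oU sf)).
apply: (smooth_linear (mulmxr (row_mx (0 : 'M[R]_(3, 4)) (1%:M : 'M[R]_3))) oV).
apply: (smoothD oV).
  apply: (smooth_bilinear (@mulmx R 1 1 3) oV).
    exact: (smooth_linear t oV (smooth_id oV)).
  exact: (smooth_precomp p oU (asd_field_smooth A oU sf)).
exact: (smooth_linear c oV (smooth_precomp p oU ss)).
Qed.

Lemma continuous_dotv (R : realType) (T : topologicalType) n (a b : T -> 'rV[R]_n) x :
  {for x, continuous a} -> {for x, continuous b} ->
  {for x, continuous (fun y => dotv (a y) (b y))}.
Proof.
move=> ca cb.
have -> : (fun y => dotv (a y) (b y)) = (fun y => \sum_i a y 0 i * b y 0 i).
  by apply/funext => y; rewrite dotvE.
apply: (@cvg_big _ _ _ _ _ _ _ _ _ (fun i y => a y 0 i * b y 0 i) (fun i => a x 0 i * b x 0 i)).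
- exact: add_continuous.
- move=> i _; apply: cvgM.
  + exact: (continuous_comp ca (@coord_continuous _ _ _ 0 i (a x))).
  + exact: (continuous_comp cb (@coord_continuous _ _ _ 0 i (b x))).
Qed.

(* The inverse of the affine parametrization t |-> t W + s of the fibre depends
   continuously on W != 0, on s and on the point. *)
Lemma X_param_open (R : realType) (W s : 'rV[R]_2 -> 'rV[R]_3)
    (z : 'rV[R]_(2 + 1)) (V : set 'rV[R]_(2 + 1)) :
  {for lsubmx z, continuous W} -> {for lsubmx z, continuous s} ->
  W (lsubmx z) != 0 -> nbhs z V ->
  exists N1 N2, [/\ nbhs (lsubmx z) N1,
    nbhs (rsubmx z *m W (lsubmx z) + s (lsubmx z)) N2 &
    forall q (t : 'rV[R]_1), N1 q -> W q != 0 -> N2 (t *m W q + s q) -> V (row_mx q t)].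
Proof.
set q0 := lsubmx z => cW cs W0 nV.
(* Orthogonal projection onto the line of [W] recovers [t] by a formula that makes sense for every
   point of the ambient space, not only for those of the form [t W + s]. *)
pose tau (x : 'rV[R]_2 * 'rV[R]_3) := dotv (x.2 - s x.1) (W x.1) / dotv (W x.1) (W x.1).
pose Z x := x.1 *m row_mx (1%:M : 'M[R]_2) (0 : 'M[R]_(2, 1)) +
            (tau x)%:M *m row_mx (0 : 'M[R]_(1, 2)) (1%:M : 'M[R]_1).
have ZE q r : Z (q, r) = row_mx q (tau (q, r))%:M.
  by rewrite /Z /= !mul_mx_row !mulmx1 !mulmx0 add_row_mx addr0 add0r.
have tauE q (t : 'rV[R]_1) : W q != 0 -> tau (q, t *m W q + s q) = t 0 0.
  move=> Wq; rewrite /tau /= addrK {1}[t]mx11_scalar mul_scalar_mx dotvZl mulfK //.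
  by rewrite gt_eqF // /dotv row_sqr_gt0.
pose x0 := (q0, rsubmx z *m W q0 + s q0).
have Zx0 : Z x0 = z.
  by rewrite ZE tauE // -mx11_scalar hsubmxK.
have ctau : {for x0, continuous tau}.
  have c1 : {for x0, continuous (fun x : 'rV[R]_2 * 'rV[R]_3 => W x.1)}.
    by apply: (@continuous_comp _ _ _ fst W); [exact: cvg_fst | exact: cW].
  have c2 : {for x0, continuous (fun x : 'rV[R]_2 * 'rV[R]_3 => s x.1)}.
    by apply: (@continuous_comp _ _ _ fst s); [exact: cvg_fst | exact: cs].
  have c3 : {for x0, continuous (fun x : 'rV[R]_2 * 'rV[R]_3 => x.2 - s x.1)}.
    by apply: continuousB; [exact: cvg_snd | exact: c2].
  apply: continuousM; first exact: continuous_dotv.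
  apply: (@continuousV _ _ (fun x : 'rV[R]_2 * 'rV[R]_3 => dotv (W x.1) (W x.1))).
    by rewrite gt_eqF // /dotv row_sqr_gt0.
  exact: continuous_dotv.
have cZ : {for x0, continuous Z}.
  apply: continuousD.
    apply: (@continuous_comp _ _ _ fst (mulmxr (row_mx (1%:M : 'M[R]_2) (0 : 'M[R]_(2, 1))))).
      exact: cvg_fst.
    exact: linear_mx_continuous.
  have -> : (fun x => (tau x)%:M *m row_mx (0 : 'M[R]_(1, 2)) (1%:M : 'M[R]_1)) =
            (fun x => tau x *: row_mx (0 : 'M[R]_(1, 2)) (1%:M : 'M[R]_1)).
    by apply/funext => x; rewrite mul_scalar_mx.
  exact: continuousZr_tmp.
have /cZ [[N1 N2] /= [n1 n2] NV] : nbhs (Z x0) V by rewrite Zx0.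
exists N1, N2; split=> // q t N1q Wq N2t.
have := NV (q, t *m W q + s q) (conj N1q N2t).
by rewrite /= ZE tauE // -mx11_scalar.
Qed.

Lemma X_param_local (R : realType) (L : set 'rV[R]_4)
    (o : 'rV[R]_4 -> 'M[R]_(2, 4) -> Prop) sigma U f (A : 'M[R]_2) :
  orients L o -> smooth_section_F L o sigma ->
  local_param L U f -> A \in unitmx ->
  local_param (X_sigma L o sigma) (@lsubmx R 1 2 1 @^-1` U) (X_param f A sigma).
Proof.
move=> oL sF pf uA; have [oU sf imm injf hf] := pf.
have ss : smooth_on U (sigma \o f) by have [_] := sF; apply.
have sW := asd_field_smooth A oU sf.
have W0 q : U q -> asd_field f A q != 0 by move=> Uq; exact: asd_field_neq0 pf Uq uA.
have free q : U q -> row_free (asd_field f A q) by move=> /W0; rewrite /row_free rank_rV => ->.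
pose p : {linear 'rV[R]_(2 + 1) -> 'rV[R]_2} := lsubmx.
have mem z : U (lsubmx z) -> X_sigma L o sigma (X_param f A sigma z).
  by move=> Uz; apply/(X_memE _ oL sF pf Uz uA); exists (rsubmx z).
split.
- by apply: (open_comp (f := p)) => // x _; exact: linear_mx_continuous.
- exact: X_param_smooth.
- move=> z w Uz; rewrite X_param_derive; first last.
  + exact: smooth_differentiable ss Uz.
  + exact: smooth_differentiable sW Uz.
  + exact: smooth_differentiable sf Uz.
  (* The base component kills the surface part of [w]; the fibre component is then a multiple of the
     nonzero vector [asd_field f A]. *)
  rewrite -row_mx0 => /eq_row_mx[/(imm _ _ Uz) lw0].
  rewrite lw0 !derive0 mulmx0 addr0 linear0 addr0 => /eqP.
  rewrite mulmx_free_eq0; last exact: free.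
  by move=> /eqP rw0; rewrite -[w](@hsubmxK _ 1 2 1) lw0 rw0 row_mx0.
- move=> z z' Uz Uz' /eq_row_mx[/(injf _ _ Uz Uz') lE].
  rewrite lE => /addIr /(row_free_inj (free _ Uz')) rE.
  by rewrite -[z](@hsubmxK _ 1 2 1) -[z'](@hsubmxK _ 1 2 1) lE rE.
- move=> V oV VU.
  pose X := X_sigma L o sigma; pose F := X_param f A sigma.
  (* The largest open set whose points in [X] lie in F(V); it remains to find, around each point of
     F(V), a neighbourhood with this property. *)
  exists ([set y | X y -> (F @` V) y]°); first exact: open_interior.
  apply/seteqP; split=> [y [z Vz <-]|y [Xy]]; last by move/interior_subset; apply.
  split; first exact/mem/VU.
  have Uz := VU _ Vz.
  pose s := fun q => asd_coef (sigma (f q)).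
  have cs : {for lsubmx z, continuous s}.
    apply: (@continuous_comp _ _ _ (sigma \o f) (@asd_coef R)).
      exact: smooth_continuous ss Uz.
    exact: linear_mx_continuous.
  have cW := smooth_continuous sW Uz.
  have nV : nbhs z V by exact: (open_near oV Vz).
  have [N1 [N2 [n1 n2 NV]]] := X_param_open cW cs (W0 _ Uz) nV.
  (* Since f(N) is relatively open in L, base points close to that of [F z] have parameters in
     [N1]. *)
  pose N := U `&` N1°.
  have oN : open N by apply: openI => //; exact: open_interior.
  have [Om oOm NOm] := hf N oN (@subIsetl _ U _).
  have Ofz : Om (f (lsubmx z)).
    have : (f @` N) (f (lsubmx z)) by exists (lsubmx z) => //; split=> //; exact: n1.
    by rewrite NOm => -[].
  have nl : \forall y \near F z, Om (lsubmx y).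
    have : {for F z, continuous (@lsubmx R 1 4 3)} by exact: linear_mx_continuous.
    by apply; rewrite /F row_mxKl; exact: (open_near oOm Ofz).
  have nr : \forall y \near F z, N2 (rsubmx y).
    have : {for F z, continuous (@rsubmx R 1 4 3)} by exact: linear_mx_continuous.
    by apply; rewrite /F row_mxKr.
  rewrite /interior; move: nl nr; apply: filterS2 => x Ox N2x Xx.
  have : (f @` N) (lsubmx x) by rewrite NOm; split=> //; have [] := Xx.
  move=> [q [Uq /interior_subset N1q] fq].
  have xE : x = row_mx (f q) (rsubmx x) by rewrite fq hsubmxK.
  move: Xx N2x; rewrite /X xE => + N2x; move/(X_memE _ oL sF pf Uq uA) => [t tE].
  rewrite row_mxKr in N2x.
  exists (row_mx q t); last by rewrite /F /X_param row_mxKl row_mxKr -tE.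
  by apply: NV => //; [exact: W0 | rewrite /s -tE].
Qed.

(** * Tangent spaces of X_sigma *)

(* Otherwise failing unifications unfold derivatives into limits. *)
Opaque derive.

(** The vertical part of the derivative of t W + sigma in a surface direction, for constant [t] and
    W = [asd_field f A]. *)
Definition fibre_part (R : realType) (f : 'rV[R]_2 -> 'rV[R]_4) (A : 'M[R]_2)
    (sigma : 'rV[R]_4 -> 'M[R]_4) (q : 'rV[R]_2) (t : R) (i : 'I_2) : 'rV[R]_3 :=
  t *: 'D_(row i A) (asd_field f A) q + asd_coef ('D_(row i A) (sigma \o f) q).

Lemma asd_field1 (R : realType) (U : set 'rV[R]_2) f (A : 'M[R]_2) q :
  smooth_on U f -> U q -> A \in unitmx ->
  asd_field f 1%:M q = (\det A)^-1 *: asd_field f A q.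
Proof.
move=> sf Uq uA; have df := smooth_differentiable sf Uq.
rewrite !asd_field_rows // mul1mx asd_rows_mull scalerA mulVf ?scale1r //.
by rewrite -unitfE -unitmxE.
Qed.

Lemma derive_asd_field1 (R : realType) (U : set 'rV[R]_2) f (A : 'M[R]_2) q w :
  open U -> smooth_on U f -> U q -> A \in unitmx ->
  'D_w (asd_field f 1%:M) q = (\det A)^-1 *: 'D_w (asd_field f A) q.
Proof.
move=> oU sf Uq uA.
have dA := smooth_differentiable (asd_field_smooth A oU sf) Uq.
apply: (eq_trans _ (deriveZ _ (diff_derivable (v := w) dA))).
apply: near_eq_derive; move: (open_near oU Uq); apply: filterS => y Uy.
exact: asd_field1 sf Uy uA.
Qed.

(** The chart uses the generator [asd_field f 1%:M], fixed once for all points, whereas [A] is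
    adapted to a single point. The two generators differ by the factor [\det A], which explains both
    the fibre coordinate [t * \det A] and the last block of the frame. *)
Lemma X_param_push_frame (R : realType) (L : set 'rV[R]_4)
    (o : 'rV[R]_4 -> 'M[R]_(2, 4) -> Prop) sigma U f q (A : 'M[R]_2) (t : R) :
  smooth_section_F L o sigma -> local_param L U f -> U q -> A \in unitmx ->
  push_frame (X_param f 1%:M sigma) (row_mx q (t * \det A)%:M)
    (block_mx A 0 0 (\det A)%:M : 'M[R]_(2 + 1)) =
  row_mx (col_mx (A *m jacobian f q) 0)
    (col_mx (\matrix_i fibre_part f A sigma q t i) (asd_field f A q)).
Proof.
move=> sF pf Uq uA; have [oU sf _ _ _] := pf.
have ss : smooth_on U (sigma \o f) by have [_] := sF; apply.
have df := smooth_differentiable sf Uq.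
have ds := smooth_differentiable ss Uq.
have dW := smooth_differentiable (asd_field_smooth 1%:M oU sf) Uq.
have d0 : \det A != 0 by rewrite -unitfE -unitmxE.
set z := row_mx q _.
have zl : lsubmx z = q by rewrite row_mxKl.
have zr : rsubmx z = (t * \det A)%:M by rewrite row_mxKr.
have XE w : 'D_w (X_param f 1%:M sigma) z = row_mx ('D_(lsubmx w) f q)
    (rsubmx w *m asd_field f 1%:M q
     + (t * \det A)%:M *m 'D_(lsubmx w) (asd_field f 1%:M) q
     + asd_coef ('D_(lsubmx w) (sigma \o f) q)).
  have := @X_param_derive R f 1%:M sigma z w; rewrite zl zr; exact.
apply/row_matrixP => i; rewrite rowK XE row_row_mx.
have [i' ->|i' ->] := @split_ordP 2 1 i.
  rewrite block_mxEv !(@rowKu _ 2 1) row_row_mx row0 row_mxKl row_mxKr mul0mx add0r.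
  rewrite row_mul rowK /fibre_part.
  have E1 : 'D_(row i' A) f q = row i' A *m 'J f q by apply: (deriveEjacobian _ df).
  have E2 := derive_asd_field1 (row i' A) oU sf Uq uA.
  have E3 : (t * \det A)%:M *m 'D_(row i' A) (asd_field f 1%:M) q =
            t *: 'D_(row i' A) (asd_field f A) q.
    rewrite mul_scalar_mx; apply: (eq_trans (congr1 (fun v => _ *: v) E2)).
    by rewrite scalerA mulfK.
  exact: (congr2 (fun x y => row_mx x (y + asd_coef _)) E1 E3).
rewrite block_mxEv !(@rowKd _ 2 1) row_row_mx row0 row_mxKl row_mxKr.
rewrite !derive0 mulmx0 linear0 !addr0 !ord1; congr row_mx.
  by rewrite row0.
rewrite (asd_field1 sf Uq uA) -scalemxAr [row 0 _](_ : _ = (\det A)%:M); last first.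
  by apply/rowP => j; rewrite !mxE !ord1.
rewrite mul_scalar_mx scalerA mulVf // scale1r.
by apply/rowP => j; rewrite [RHS]mxE.
Qed.

Lemma asd_form_is_linear (R : realType) : linear (@asd_form R).
Proof. by move=> c a b; rewrite asd_formD asd_formZ. Qed.

HB.instance Definition _ (R : realType) :=
  GRing.isLinear.Build R 'rV[R]_3 'M[R]_4 _ (@asd_form R) (@asd_form_is_linear R).

(** The anti-self-dual forms are the fixed space of the linear map [asd_form \o asd_coef], which
    commutes with differentiation. *)
Lemma derive_anti_self_dual (R : realType) (U : set 'rV[R]_2)
    (s : 'rV[R]_2 -> 'M[R]_4) q w : open U -> U q -> differentiable s q ->
  (forall y, U y -> anti_self_dual (s y)) ->
  asd_form (asd_coef ('D_w s q)) = 'D_w s q.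
Proof.
move=> oU Uq ds asd_s.
pose c : {linear 'M[R]_4 -> 'rV[R]_3} := @asd_coef R.
pose a : {linear 'rV[R]_3 -> 'M[R]_4} := @asd_form R.
have [dc _] := linear_mx_is_diff c (s q).
have dcs : differentiable (c \o s) q by exact: differentiable_comp.
apply: (eq_trans (congr1 a (esym (derive_linear c w ds)))).
apply: (eq_trans (esym (derive_linear a w dcs))).
apply: near_eq_derive; move: (open_near oU Uq); apply: filterS => y Uy.
exact: (anti_self_dualK (asd_s y Uy)).
Qed.

(** Pairing omega^2 or omega^3 with a tangent vector in one slot sees only the normal components of
    the other: this is how second derivatives enter through the second fundamental form. *)
Lemma omega23_contract (R : realType) (e : 'M[R]_4) h : e *m e^T = 1%:M ->
  [/\ dotv (h *m omega2 e) (row 1 e) = - dotv h (row 3 e),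
      dotv (row 0 e *m omega2 e) h = dotv h (row 2 e),
      dotv (h *m omega3 e) (row 1 e) = dotv h (row 2 e) &
      dotv (row 0 e *m omega3 e) h = dotv h (row 3 e)].
Proof.
move=> ee; have frame i j := dotv_frame i j ee.
by split; rewrite /omega2 /omega3 mulmxBr dotvBl !dotv_wedge !frame /=;
  rewrite ?[dotv _ h]dotvC; ring.
Qed.

Lemma derive_asd_field (R : realType) (U : set 'rV[R]_2) f (A : 'M[R]_2) q w :
  smooth_on U f -> U q ->
  'D_w (asd_field f A) q =
    asd_wedge ('D_w (fun y => 'D_(row 0 A) f y) q) ('D_(row 1 A) f q) +
    asd_wedge ('D_(row 0 A) f q) ('D_w (fun y => 'D_(row 1 A) f y) q).
Proof.
move=> sf Uq.
have d0 := smooth_differentiable (smooth_derive (row 0 A) sf) Uq.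
have d1 := smooth_differentiable (smooth_derive (row 1 A) sf) Uq.
exact: (derive_bilinear (@asd_wedge R) w d0 d1).
Qed.

(* Twice the mean curvature vector of the surface, when the vectors df(row 0 A)
   and df(row 1 A) are orthonormal, up to a tangential component. *)
Definition frame_trace (R : realType) (f : 'rV[R]_2 -> 'rV[R]_4) (A : 'M[R]_2)
    (q : 'rV[R]_2) : 'rV[R]_4 :=
  'D_(row 0 A) (fun y => 'D_(row 0 A) f y) q +
  'D_(row 1 A) (fun y => 'D_(row 1 A) f y) q.

(** Both sums are the components of b0 + J b1 in F. The complex structure pairs the normal
    components of [h01] with opposite signs, so they cancel and only the trace [h00 + h11] is
    left. *)
Lemma asd_wedge_trace (R : realType) (e : 'M[R]_4) (c2 c3 : 'rV[R]_3)
    (h00 h01 h11 : 'rV[R]_4) : e *m e^T = 1%:M ->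
  asd_form c2 = omega2 e -> asd_form c3 = omega3 e ->
  let b0 := asd_wedge h00 (row 1 e) + asd_wedge (row 0 e) h01 in
  let b1 := asd_wedge h01 (row 1 e) + asd_wedge (row 0 e) h11 in
  dotv b0 c2 - dotv b1 c3 = - dotv (h00 + h11) (row 3 e) /\
  dotv b0 c3 + dotv b1 c2 = dotv (h00 + h11) (row 2 e).
Proof.
move=> ee c2E c3E /=; rewrite !dotvDl !asd_wedgeE c2E c3E.
have [z1 z2 z3 z4] := omega23_contract h00 ee.
have [z5 z6 z7 z8] := omega23_contract h01 ee.
have [z9 z10 z11 z12] := omega23_contract h11 ee.
rewrite z1 z3 z5 z6 z7 z8 z10 z12.
by split; ring.
Qed.

Lemma derive_asd_field_frame (R : realType) (U : set 'rV[R]_2) f (A : 'M[R]_2) q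
    (e : 'M[R]_4) (c2 c3 : 'rV[R]_3) :
  open U -> smooth_on U f -> U q -> e *m e^T = 1%:M ->
  'D_(row 0 A) f q = row 0 e -> 'D_(row 1 A) f q = row 1 e ->
  asd_form c2 = omega2 e -> asd_form c3 = omega3 e ->
  let b i := 'D_(row i A) (asd_field f A) q in
  dotv (b 0) c2 - dotv (b 1) c3 = - dotv (frame_trace f A q) (row 3 e) /\
  dotv (b 0) c3 + dotv (b 1) c2 = dotv (frame_trace f A q) (row 2 e).
Proof.
move=> oU sf Uq ee e0 e1 c2E c3E b.
(* Symmetry identifies the two mixed derivatives with the single [h01] of [asd_wedge_trace]. As [A]
   is constant, orthonormality at [q] alone is involved. *)
have hC := schwarz (row 0 A) (row 1 A) oU sf Uq.
have b0 := derive_asd_field A (row 0 A) sf Uq.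
have b1 := derive_asd_field A (row 1 A) sf Uq.
rewrite e0 e1 in b0 b1.
have b1' := eq_trans b1 (congr1 (fun h => asd_wedge h _ + _) hC).
have := asd_wedge_trace ('D_(row 0 A) (fun y => 'D_(row 0 A) f y) q)
  ('D_(row 0 A) (fun y => 'D_(row 1 A) f y) q)
  ('D_(row 1 A) (fun y => 'D_(row 1 A) f y) q) ee c2E c3E.
move=> [t1 t2]; split.
  apply: (eq_trans _ t1).
  exact: (congr2 (fun x y => dotv x c2 - dotv y c3) b0 b1').
apply: (eq_trans _ t2).
exact: (congr2 (fun x y => dotv x c3 + dotv y c2) b0 b1').
Qed.

(** [u] and [v] are the components of a_1 + J a_2 along omega^2 and omega^3. The positivity clause
    supplies the sign that the squared identity loses. *)
Lemma phi_X_param (R : realType) (L : set 'rV[R]_4)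
    (o : 'rV[R]_4 -> 'M[R]_(2, 4) -> Prop) sigma U f q (A : 'M[R]_2)
    (e : 'M[R]_4) (t : R) :
  smooth_section_F L o sigma -> local_param L U f -> U q -> A \in unitmx ->
  e *m e^T = 1%:M -> \det e = 1 ->
  usubmx (e : 'M[R]_(2 + 2, 4)) = A *m jacobian f q ->
  let Y : 'M[R]_(3, 4 + 3) :=
    push_frame (X_param f 1%:M sigma) (row_mx q (t * \det A)%:M)
               (block_mx A 0 0 (\det A)%:M : 'M[R]_(2 + 1)) in
  let S i := 'D_(row i A) (sigma \o f) q in
  let H := frame_trace f A q in
  let u := t * - dotv H (row 3 e)
           + (dot_form (S 0) (omega2 e) - dot_form (S 1) (omega3 e)) in
  let v := t * dotv H (row 2 e)
           + (dot_form (S 0) (omega3 e) + dot_form (S 1) (omega2 e)) in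
  \det (Y *m Y^T) = phi Y ^+ 2 + (u ^+ 2 + v ^+ 2) /\
  (u = 0 -> v = 0 -> 0 < phi Y).
Proof.
move=> sF pf Uq uA ee de eE Y S H u v.
have [oU sf _ _ _] := pf.
have ss : smooth_on U (sigma \o f) by have [_] := sF; apply.
have df := smooth_differentiable sf Uq.
have ds := smooth_differentiable ss Uq.
have [C [CC dC [C0 C1 C2]]] := asd_frame ee de.
have [r0 r1] := usubmx_rows e.
have e0 : 'D_(row 0 A) f q = row 0 e.
  by apply: (eq_trans (deriveEjacobian _ df)); rewrite -row_mul -eE.
have e1 : 'D_(row 1 A) f q = row 1 e.
  by apply: (eq_trans (deriveEjacobian _ df)); rewrite -row_mul -eE.
have W0 : asd_field f A q = row 0 C.
  apply: (can_inj (@asd_formK R)).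
  by rewrite asd_field_rows // C0 -eE; exact: asd_rows_frame.
have asdS i : asd_form (asd_coef (S i)) = S i.
  apply: (derive_anti_self_dual _ oU Uq ds) => y Uy.
  by have [sFp _] := sF; have [] := sFp _ (param_mem pf Uy).
pose Q : 'M[R]_(2 + 1, 3) :=
  col_mx (\matrix_i fibre_part f A sigma q t i) (asd_field f A q).
pose K : 'M[R]_3 := (Q : 'M[R]_3) *m C^T.
have QE : (Q : 'M[R]_3) = K *m C by rewrite -mulmxA (mulmx1C CC) mulmx1.
have K2 : row 2 K = delta_mx 0 0.
  rewrite row_mul (_ : row 2 (Q : 'M[R]_3) = row 0 C).
    apply/rowP => j; rewrite mulmx_trE mxE /=.
    rewrite (_ : row 0 (row 0 C) = row 0 C); last by apply/rowP => k; rewrite mxE.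
    by rewrite dotv_frame // eq_sym.
  rewrite (_ : row 2 _ = row (rshift 2 0) Q); last by congr row; exact/val_inj.
  by rewrite (@rowKd _ 2 1) W0; apply/rowP => k; rewrite mxE.
have KE (i : 'I_2) j : K (lshift 1 i) j = dotv (fibre_part f A sigma q t i) (row j C).
  by rewrite /K mulmx_trE (@rowKu _ 2 1) rowK.
have YE : Y = row_mx (col_mx (usubmx (e : 'M[R]_(2 + 2, 4))) (0 : 'rV[R]_4)) (K *m C).
  by rewrite /Y (X_param_push_frame t sF pf Uq uA) -QE eE.
have [phiY detY] := phi_frame ee CC dC C0 K2; rewrite -YE in phiY detY.
have SE i j : dotv (asd_coef (S i)) (row j C) = dot_form (S i) (asd_form (row j C)).
  by rewrite -dot_form_asd asdS.
have FE (i : 'I_2) j w : asd_form (row j C) = w -> K (lshift 1 i) j =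
    t * dotv ('D_(row i A) (asd_field f A) q) (row j C) + dot_form (S i) w.
  by move=> <-; rewrite KE /fibre_part dotvDl dotvZl; congr (_ + _); exact: SE.
have K0E j : K 0 j = K (lshift 1 (0 : 'I_2)) j by congr (K _ _); exact/val_inj.
have K1E j : K 1 j = K (lshift 1 (1 : 'I_2)) j by congr (K _ _); exact/val_inj.
have [bu bv] := derive_asd_field_frame oU sf Uq ee e0 e1 C1 C2.
have uE : K 0 1 - K 1 2 = u.
  apply: (eq_trans (congr2 (fun x y => x - y) (eq_trans (K0E 1) (FE 0 1 _ C1))
                                              (eq_trans (K1E 2) (FE 1 2 _ C2)))).
  apply: (eq_trans _ (congr1 (fun h => t * h + _) bu)).
  by rewrite mulrBr opprD addrACA.
have vE : K 0 2 + K 1 1 = v.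
  apply: (eq_trans (congr2 (fun x y => x + y) (eq_trans (K0E 2) (FE 0 2 _ C2))
                                              (eq_trans (K1E 1) (FE 1 1 _ C1)))).
  apply: (eq_trans _ (congr1 (fun h => t * h + _) bv)).
  by rewrite mulrDr addrACA.
split; first by rewrite detY uE vE.
(* When [u] and [v] vanish, [phi] is 1 plus a sum of two squares. *)
have pos (a b c d : R) : a - b = 0 -> c + d = 0 -> 0 < 1 + (a * b - c * d).
  move=> /eqP; rewrite subr_eq0 => /eqP -> /eqP; rewrite addr_eq0 => /eqP ->.
  by rewrite mulNr opprK ltr_pwDl // addr_ge0 // -expr2 sqr_ge0.
move=> u0 v0; rewrite phiY; exact: pos (eq_trans uE u0) (eq_trans vE v0).
Qed.

(** * The Cauchy-Riemann operator in a frame *)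

Lemma dot_formD2l (R : realType) (a b : R) (X Y w : 'M[R]_4) :
  dot_form (a *: X + b *: Y) w = a * dot_form X w + b * dot_form Y w.
Proof.
by rewrite /dot_form mulmxDl -!scalemxAl mxtraceD !mxtraceZ; ring.
Qed.

Lemma derive_lin2 (R : realType) (V W : normedModType R) (g : V -> W) q
    (a b : R) (v w : V) : differentiable g q ->
  'D_(a *: v + b *: w) g q = a *: 'D_v g q + b *: 'D_w g q.
Proof.
move=> dg; apply: (eq_trans (deriveE _ dg)); rewrite linearD !linearZ /=.
exact: (congr2 (fun x y => a *: x + b *: y) (esym (deriveE v dg)) (esym (deriveE w dg))).
Qed.

Lemma omega23_orthonormal (R : realType) (e : 'M[R]_4) :
  e *m e^T = 1%:M -> \det e = 1 ->
  [/\ dot_form (omega2 e) (omega2 e) = 1, dot_form (omega2 e) (omega3 e) = 0,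
      dot_form (omega3 e) (omega2 e) = 0 & dot_form (omega3 e) (omega3 e) = 1].
Proof.
move=> ee de; have [C [CC _ [_ <- <-]]] := asd_frame ee de.
by split; rewrite dot_form_asd dotv_frame.
Qed.

(** With omega^2, omega^3 read as 1, i, the right side is half of (a - i b) times (x S0 - y S1) + i
    (y S0 + x S1): the operator is antilinear in the direction, so its value at e_1 decides all of
    it. [D] stands for the derivative along L. *)
Lemma dbar_frame (R : realType) (e : 'M[R]_4) (D : 'rV[R]_4 -> 'M[R]_4)
    (S0 S1 : 'M[R]_4) (a b : R) :
  e *m e^T = 1%:M -> \det e = 1 ->
  (forall a b, D (a *: row 0 e + b *: row 1 e) = a *: S0 + b *: S1) ->
  let v := a *: row 0 e + b *: row 1 e in
  let x S := dot_form S (omega2 e) in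
  let y S := dot_form S (omega3 e) in
  2^-1 *: (proj_F e (D v) + J_F e (proj_F e (D (J_L e v)))) =
  2^-1 *: ((a * (x S0 - y S1) + b * (y S0 + x S1)) *: omega2 e
        + (a * (y S0 + x S1) - b * (x S0 - y S1)) *: omega3 e).
Proof.
move=> ee de DE v x y; congr (_ *: _).
have [ow22 ow23 ow32 ow33] := omega23_orthonormal ee de.
have fr i j := dotv_frame i j ee.
have -> : J_L e v = - b *: row 0 e + a *: row 1 e.
  rewrite /J_L /v !dotvDl !dotvZl !fr /= !mulr0 !mulr1 addr0 add0r.
  by rewrite scaleNr addrC.
rewrite !DE /proj_F /J_F !dot_formD2l ow22 ow23 ow32 ow33 -/(x S0) -/(x S1) -/(y S0) -/(y S1).
move: (x S0) (x S1) (y S0) (y S1) (omega2 e) (omega3 e) => x0 x1 y0 y1 w2 w3.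
by apply/matrixP => i j; rewrite !mxE; ring.
Qed.

Lemma mulmx_rV2 (R : realType) n (w : 'rV[R]_2) (A : 'M[R]_(2, n)) :
  w *m A = w 0 0 *: row 0 A + w 0 1 *: row 1 A.
Proof.
apply/rowP => j; rewrite mxE !big_ord_recl big_ord0 addr0 !mxE.
by congr (w _ _ * A _ _ + w _ _ * A _ _); apply/val_inj.
Qed.

Lemma dbar_at (R : realType) (L : set 'rV[R]_4) sigma U f q (A : 'M[R]_2) (e : 'M[R]_4) :
  local_param L U f -> U q -> differentiable (sigma \o f) q -> A \in unitmx ->
  e *m e^T = 1%:M -> \det e = 1 ->
  usubmx (e : 'M[R]_(2 + 2, 4)) = A *m jacobian f q ->
  let S i := 'D_(row i A) (sigma \o f) q in
  (forall v, tangent 2 L (f q) v -> dbar_F L e sigma (f q) v = 0) <->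
  (dot_form (S 0) (omega2 e) - dot_form (S 1) (omega3 e) = 0 /\
   dot_form (S 0) (omega3 e) + dot_form (S 1) (omega2 e) = 0).
Proof.
move=> pf Uq ds uA ee de eE S.
have [r0 r1] := usubmx_rows e.
have fE a b : a *: row 0 e + b *: row 1 e = (a *: row 0 A + b *: row 1 A) *m jacobian f q.
  by rewrite -r0 -r1 eE !row_mul mulmxDl -!scalemxAl.
have DE a b : deriv_along 2 L sigma (f q) (a *: row 0 e + b *: row 1 e) =
    a *: S 0 + b *: S 1.
  rewrite fE; apply: (eq_trans (deriv_alongE _ pf Uq ds)).
  exact: derive_lin2.
have dE a b := dbar_frame a b ee de DE.
have [ow22 ow23 ow32 ow33] := omega23_orthonormal ee de.
split=> [dbar0|[u0 v0] v].
  have te : tangent 2 L (f q) (1 *: row 0 e + 0 *: row 1 e).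
    by apply/(tangentE _ pf Uq); rewrite fE; eexists.
  have := eq_trans (esym (dE 1 0)) (dbar0 _ te).
  move: (_ - _) (_ + dot_form (S 1) _) => u v.
  rewrite !mul1r !mul0r addr0 subr0 => /eqP.
  rewrite scaler_eq0 invr_eq0 pnatr_eq0 /= => /eqP uv0.
  have z w : dot_form 0 w = 0 :> R.
    by rewrite /dot_form mul0mx mxtrace0 mulr0.
  split.
    have := congr1 (fun X => dot_form X (omega2 e)) uv0.
    by rewrite dot_formD2l ow22 ow32 z mulr1 mulr0 addr0.
  have := congr1 (fun X => dot_form X (omega3 e)) uv0.
  by rewrite dot_formD2l ow23 ow33 z mulr1 mulr0 add0r.
move=> /(tangentE _ pf Uq)[w wE].
have vE : v = (w *m invmx A) 0 0 *: row 0 e + (w *m invmx A) 0 1 *: row 1 e.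
  by rewrite fE wE -mulmx_rV2 mulmxKV.
rewrite vE; apply: (eq_trans (dE _ _)); rewrite u0 v0.
by rewrite !mulr0 addr0 subr0 !scale0r addr0 scaler0.
Qed.

(** * Associativity, minimality and holomorphy as pointwise equations *)

Lemma orthonormal_unit (R : realType) k n (A : 'M[R]_k) (J : 'M[R]_(k, n)) :
  (A *m J) *m (A *m J)^T = 1%:M -> A \in unitmx.
Proof. by rewrite -mulmxA => /mulmx1_unit[]. Qed.

Lemma frame_unit (R : realType) k n (e : 'M[R]_(k + n)) (A : 'M[R]_k)
    (J : 'M[R]_(k, k + n)) :
  e *m e^T = 1%:M -> usubmx e = A *m J -> A \in unitmx.
Proof.
move=> ee eE; apply: (orthonormal_unit (J := J)); rewrite -eE.
move: ee; rewrite -{1 2}[e]vsubmxK tr_col_mx mul_col_row scalar_mx_block.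
by move=> /eq_block_mx[].
Qed.

Lemma det_gram (R : realType) k n (B : 'M[R]_k) (J : 'M[R]_(k, n)) :
  \det ((B *m J) *m (B *m J)^T) = \det B ^+ 2 * \det (J *m J^T).
Proof.
by rewrite trmx_mul mulmxA -(mulmxA B) det_mulmx det_mulmx det_tr mulrAC -expr2.
Qed.

Lemma second_fundamental_trace (R : realType) (f : 'rV[R]_2 -> 'rV[R]_4) q
    (A : 'M[R]_2) nu :
  \sum_(i < 2) second_fundamental_form f q nu (row i A) (row i A) =
  dotv (frame_trace f A q) nu.
Proof.
apply: (eq_trans (sum2E _)); exact: (esym (dotvDl _ _ _)).
Qed.

(* An associative plane is one on which phi^2 is the Gram determinant. *)
Lemma associative_gram (R : realType) (X : set 'rV[R]_(4 + 3))
    (V : set 'rV[R]_3) (F : 'rV[R]_3 -> 'rV[R]_(4 + 3)) z :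
  associative_submanifold X -> local_param X V F -> V z ->
  \det (jacobian F z *m (jacobian F z)^T) = phi (jacobian F z) ^+ 2.
Proof.
move=> [_ [ori [oriX aX]]] pF Vz.
have XFz := param_mem pF Vz.
have [V' [G [pG [z' V'z' Gz'] oriE]]] := oriX _ XFz.
have dG := param_differentiable pG V'z'.
(* The orientation is known only in its own chart [G], so an oriented orthonormal basis is built
   there and carried to [F] by the transition matrix. *)
have [T JE uT] := chart_jacobian pG pF V'z' Vz Gz'.
have [B dB BB] := param_onb pG V'z'.
have phi1 : phi (B *m jacobian G z') = 1.
  apply: (aX (F z) _ XFz); split=> //.
    by rewrite -Gz'; apply/(tangent_rowsP _ pG V'z'); exists B.
  by rewrite -Gz' -push_frameE //; apply/oriE.
have uB : B \in unitmx := orthonormal_unit BB.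
have -> : jacobian F z = (T *m invmx B) *m (B *m jacobian G z').
  by rewrite mulmxA mulmxKV.
by rewrite det_gram phi_mull phi1 BB det1 !mulr1.
Qed.

(** Passes from the adapted frame to the Jacobian of the chart. The matrix [B] between them has
    determinant [\det A ^+ 2], so the sign of [phi] survives even when [A] reverses the
    orientation. *)
Lemma X_param_gram (R : realType) (L : set 'rV[R]_4)
    (o : 'rV[R]_4 -> 'M[R]_(2, 4) -> Prop) sigma U f q (A : 'M[R]_2)
    (e : 'M[R]_4) (t : R) :
  orients L o -> smooth_section_F L o sigma -> local_param L U f -> U q ->
  e *m e^T = 1%:M -> \det e = 1 ->
  usubmx (e : 'M[R]_(2 + 2, 4)) = A *m jacobian f q ->
  let J : 'M[R]_(3, 4 + 3) :=
    jacobian (X_param f 1%:M sigma) (row_mx q (t * \det A)%:M) in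
  let S i := 'D_(row i A) (sigma \o f) q in
  let H := frame_trace f A q in
  let u := t * - dotv H (row 3 e)
           + (dot_form (S 0) (omega2 e) - dot_form (S 1) (omega3 e)) in
  let v := t * dotv H (row 2 e)
           + (dot_form (S 0) (omega3 e) + dot_form (S 1) (omega2 e)) in
  (\det (J *m J^T) = phi J ^+ 2 -> u = 0 /\ v = 0) /\
  (u = 0 -> v = 0 -> \det (J *m J^T) = phi J ^+ 2 /\ 0 < phi J).
Proof.
move=> oL sF pf Uq ee de eE J S H u v.
have uA := frame_unit (k := 2) (n := 2) ee eE.
have pF := X_param_local oL sF pf (unitmx1 _ _).
have Uz : (@lsubmx R 1 2 1 @^-1` U) (row_mx q (t * \det A)%:M) by rewrite /= row_mxKl.
have dF := param_differentiable pF Uz.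
have := phi_X_param t sF pf Uq uA ee de eE.
rewrite /= (push_frameE _ dF) -/J -/S -/H -/u -/v.
set B : 'M[R]_3 := block_mx A 0 0 _ => -[detE posE].
have detB : \det B = \det A ^+ 2.
  by rewrite (@det_ublock _ 2 1) det_scalar1 expr2.
have B0 : 0 < \det B by rewrite detB exprn_even_gt0 //= -unitfE -unitmxE.
rewrite det_gram phi_mull exprMn in detE; rewrite phi_mull in posE.
split=> [JJ|u0 v0].
  move: detE; rewrite JJ => /eqP; rewrite -[X in X == _]addr0.
  rewrite (inj_eq (addrI _)) eq_sym paddr_eq0 ?sqr_ge0 // !sqrf_eq0.
  by move=> /andP[/eqP -> /eqP ->].
split; last by have := posE u0 v0; rewrite pmulr_rgt0.
move: detE; rewrite u0 v0 expr0n addr0 addr0.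
by move=> /mulfI; apply; rewrite sqrf_eq0 gt_eqF.
Qed.

Lemma normal_frame (R : realType) (L : set 'rV[R]_4) U f q (A : 'M[R]_2)
    (e : 'M[R]_4) :
  local_param L U f -> U q -> A \in unitmx -> e *m e^T = 1%:M ->
  usubmx (e : 'M[R]_(2 + 2, 4)) = A *m jacobian f q ->
  forall nu, normal_vector 2 L (f q) nu <->
    nu = dotv nu (row 2 e) *: row 2 e + dotv nu (row 3 e) *: row 3 e.
Proof.
move=> pf Uq uA ee eE nu; have [r0 r1] := usubmx_rows e.
have fr i j := dotv_frame i j ee.
split=> [nnu|-> v /(tangentE _ pf Uq)[w ->]].
  have te i : tangent 2 L (f q) (row i (usubmx (e : 'M[R]_(2 + 2, 4)))).
    by move: i; rewrite eE; apply/(tangent_rowsP _ pf Uq); exists A.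
  have n0 : dotv nu (row 0 e) = 0 by rewrite dotvC -r0; exact: nnu.
  have n1 : dotv nu (row 1 e) = 0 by rewrite dotvC -r1; exact: nnu.
  rewrite -{1}[nu]mulmx1 -(mulmx1C ee) mulmxA mulmx_sum_row sum4E.
  have E i : (nu *m e^T) 0 i = dotv nu (row i e).
    by rewrite mulmx_trE; congr dotv; apply/rowP => j; rewrite mxE.
  by rewrite !E n0 n1 !scale0r !add0r.
have -> : w *m jacobian f q = (w *m invmx A) 0 0 *: row 0 e + (w *m invmx A) 0 1 *: row 1 e.
  by rewrite -r0 -r1 -mulmx_rV2 eE mulmxA mulmxKV.
rewrite dotvDl !dotvZl ![dotv (row _ e) _]dotvC !dotvDl !dotvZl !fr /=.
by rewrite !(mulr0, addr0).
Qed.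

Lemma minimal_frame (R : realType) (L : set 'rV[R]_4) U f q (A : 'M[R]_2)
    (e : 'M[R]_4) :
  local_param L U f -> U q -> A \in unitmx -> e *m e^T = 1%:M ->
  usubmx (e : 'M[R]_(2 + 2, 4)) = A *m jacobian f q ->
  let H := frame_trace f A q in
  (forall nu, normal_vector 2 L (f q) nu -> dotv H nu = 0) <->
  (dotv H (row 2 e) = 0 /\ dotv H (row 3 e) = 0).
Proof.
move=> pf Uq uA ee eE H; have nE := normal_frame pf Uq uA ee eE.
have fr i j := dotv_frame i j ee.
split=> [Hn|[H2 H3] nu /nE ->].
  split; apply: Hn; apply/nE; rewrite !fr /=;
    by rewrite scale0r scale1r ?addr0 ?add0r.
by rewrite dotvC dotvDl !dotvZl ![dotv _ H]dotvC H2 H3 !mulr0 addr0.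
Qed.

(** The frame [e] may induce either orientation on L, because [minimal] tests every orthonormal
    tangent frame. Reversing the orientation changes the sign of both complex structures, which
    leaves dbar unchanged. *)
Lemma associative_equations (R : realType) (L : set 'rV[R]_4)
    (o : 'rV[R]_4 -> 'M[R]_(2, 4) -> Prop) sigma U f q (A : 'M[R]_2) (e : 'M[R]_4) :
  orients L o -> smooth_section_F L o sigma ->
  associative_submanifold (X_sigma L o sigma) ->
  local_param L U f -> U q -> e *m e^T = 1%:M -> \det e = 1 ->
  usubmx (e : 'M[R]_(2 + 2, 4)) = A *m jacobian f q ->
  (forall nu, normal_vector 2 L (f q) nu -> dotv (frame_trace f A q) nu = 0) /\
  (forall v, tangent 2 L (f q) v -> dbar_F L e sigma (f q) v = 0).
Proof.
move=> oL sF aX pf Uq ee de eE.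
have uA := frame_unit (k := 2) (n := 2) ee eE.
have pF := X_param_local oL sF pf (unitmx1 _ _).
have [oU _ _ _ _] := pf.
have ds : differentiable (sigma \o f) q.
  by have [_ ss] := sF; exact: smooth_differentiable (ss _ _ pf) Uq.
have Uz t : (@lsubmx R 1 2 1 @^-1` U) (row_mx q (t * \det A)%:M).
  by rewrite /= row_mxKl.
have eqs t := (X_param_gram t oL sF pf Uq ee de eE).1 (associative_gram aX pF (Uz t)).
(* The equations are affine in [t]: the value 0 isolates the dbar terms, and the value 1 then leaves
   the mean curvature terms. *)
have [u0 v0] := eqs 0; have [u1 v1] := eqs 1.
rewrite mul0r add0r in u0; rewrite mul0r add0r in v0.
rewrite u0 addr0 mul1r in u1; rewrite v0 addr0 mul1r in v1.
split; last by apply/(dbar_at pf Uq ds uA ee de eE).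
apply/(minimal_frame pf Uq uA ee eE); split=> //.
by apply/eqP; rewrite -oppr_eq0 u1.
Qed.

Lemma X_param_cover (R : realType) (L : set 'rV[R]_4)
    (o : 'rV[R]_4 -> 'M[R]_(2, 4) -> Prop) sigma :
  submanifold 2 L -> orients L o -> smooth_section_F L o sigma ->
  forall y, X_sigma L o sigma y -> exists U f,
    local_param L U f /\ (X_param f 1%:M sigma @` (@lsubmx R 1 2 1 @^-1` U)) y.
Proof.
move=> sL oL sF y Xy; have Ly : L (lsubmx y) by have [] := Xy.
have [U [f [pf [q Uq fq]]]] := sL _ Ly.
exists U, f; split=> //.
have yE : y = row_mx (f q) (rsubmx y) by rewrite fq hsubmxK.
move: Xy; rewrite yE => /(X_memE _ oL sF pf Uq (unitmx1 _ _))[t tE].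
exists (row_mx q t); first by rewrite /= row_mxKl.
by rewrite /X_param row_mxKl row_mxKr -tE.
Qed.

Theorem theorem3p2 (R : realType) (L : set 'rV[R]_4)
    (o : 'rV[R]_4 -> 'M[R]_(2, 4) -> Prop) (sigma : 'rV[R]_4 -> 'M[R]_4)
    (L_surface : submanifold 2 L) (L_oriented : orients L o)
    (sigma_smooth : smooth_section_F L o sigma) :
  associative_submanifold (X_sigma L o sigma) <->
  (minimal 2 L /\ holomorphic_section L o sigma).
Proof.
split=> [aX|[minL holo]].
  split=> [U f q A nu pf Uq oA nnu|p e v Lp [ee de [te _ _]] tv].
    have df := param_differentiable pf Uq; rewrite push_frameE // in oA.
    have [e [ee de eE]] := extend_SO4 oA.
    rewrite second_fundamental_trace.
    have [Hn _] := associative_equations L_oriented sigma_smooth aX pf Uq ee de eE.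
    exact: Hn.
  have [U [f [pf [q Uq fq]]]] := L_surface _ Lp; rewrite -fq in te tv *.
  have [A eE] := (tangent_rowsP _ pf Uq).1 te.
  have [_ dbar0] := associative_equations L_oriented sigma_smooth aX pf Uq ee de eE.
  exact: dbar0.
have pF U f : local_param L U f -> local_param (X_sigma L o sigma)
    (@lsubmx R 1 2 1 @^-1` U) (X_param f 1%:M sigma).
  by move=> pf; exact: X_param_local L_oriented sigma_smooth pf (unitmx1 _ _).
have charts := X_param_cover L_surface L_oriented sigma_smooth.
have jac U f (z : 'rV[R]_(2 + 1)) : local_param L U f -> U (lsubmx z) ->
    let J : 'M[R]_(3, 4 + 3) := jacobian (X_param f 1%:M sigma) z in
    \det (J *m J^T) = phi J ^+ 2 /\ 0 < phi J.
  move=> pf Uz J; set q := lsubmx z in Uz.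
  have [e ae] := exists_adapted_frame L_oriented (param_mem pf Uz).
  have [ee de [te oe _]] := ae.
  have [A eE] := (tangent_rowsP _ pf Uz).1 te.
  have uA := frame_unit (k := 2) (n := 2) ee eE.
  have d0 : \det A != 0 by rewrite -unitfE -unitmxE.
  have ds : differentiable (sigma \o f) q.
    by have [_ ss] := sigma_smooth; exact: smooth_differentiable (ss _ _ pf) Uz.
  have [u0 v0] := (dbar_at pf Uz ds uA ee de eE).1
    (fun v tv => holo _ e v (param_mem pf Uz) ae tv).
  have df := param_differentiable pf Uz.
  have [H2 H3] := (minimal_frame pf Uz uA ee eE).1 (fun nu nnu =>
    etrans (esym (second_fundamental_trace f q A nu))
      (minL U f q A nu pf Uz (etrans (congr1 (fun M => M *m M^T)
         (etrans (push_frameE A df) (esym eE))) oe) nnu)).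
  (* This [t] makes [t * \det A] the fibre coordinate of [z], so that every point of the chart is
     reached. *)
  have [_ gram] := X_param_gram (rsubmx z 0 0 / \det A) L_oriented sigma_smooth
    pf Uz ee de eE.
  have zE : row_mx q (rsubmx z 0 0 / \det A * \det A)%:M = z.
    by rewrite divfK // -mx11_scalar hsubmxK.
  rewrite H2 H3 u0 v0 oppr0 !mulr0 !add0r zE in gram.
  exact: gram.
split.
  move=> y Xy; have [U [f [pf Fy]]] := charts y Xy.
  by exists (@lsubmx R 1 2 1 @^-1` U), (X_param f 1%:M sigma); split=> //; exact: pF.
(* [X_sigma] is oriented by [phi] itself; by [jac] this is the coordinate orientation in every chart
   [X_param f 1%:M sigma]. *)
exists (fun _ B => 0 < phi B); split=> [y Xy|y B Xy [tB BB posB]].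
  have [U [f [pf Fy]]] := charts y Xy.
  exists (@lsubmx R 1 2 1 @^-1` U), (X_param f 1%:M sigma).
  split=> //; first exact: pF.
  move=> z B Uz; have [_ J0] := jac U f z pf Uz.
  rewrite push_frameE; last exact: param_differentiable (pF _ _ pf) Uz.
  by rewrite phi_mull pmulr_lgt0.
have [U [f [pf [z Uz Fz]]]] := charts y Xy.
have [JJ J0] := jac U f z pf Uz.
rewrite -Fz in tB; have [B' BE] := (tangent_rowsP _ (pF _ _ pf) Uz).1 tB.
(* The Gram determinant of an orthonormal basis is 1, so [phi] is 1 or -1 on it, and the orientation
   excludes -1. *)
have := congr1 determinant BB; rewrite det1 BE det_gram JJ -exprMn -phi_mull -BE.
move=> /eqP; rewrite sqrf_eq1 => /orP[/eqP //|/eqP B1].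
by move: posB; rewrite B1 ltr0N1.
Qed.
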